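(* Let $\Theta\subseteq\mathbb{R}^p$, $D\subseteq\mathbb{R}^l$ be closed sets with $0\in\Theta$, $0\in D$, and let $\Gamma,\varepsilon>0$. Consider $$\dot\xi=f(\xi,z,\theta,d),\qquad \dot z=\Gamma e^{-z}\big(V(\xi,z)-\varepsilon\big)^+,$$ with state $(\xi,z)\in\mathbb{R}^n\times\mathbb{R}$ and inputs $\theta\in\Theta$, $d\in D$, where $f:\mathbb{R}^n\times\mathbb{R}\times\Theta\times D\to\mathbb{R}^n$ is continuous, locally Lipschitz in $(\xi,z)$ (uniformly for $(\theta,d)$ in bounded sets), with $f(0,z,\theta,0)=0$ for all $(z,\theta)$, and $V\in C^1(\mathbb{R}^n\times\mathbb{R})$ satisfies $V(0,z)=0$ for all $z$ and $V(\xi,z)>0$ for $\xi\ne0$. Assume: (i) for every $M>0$ the set $\{(\xi,z)\in\mathbb{R}^n\times[-M,M]: V(\xi,z)\le M\}$ is bounded; (ii) there exist $\kappa,\lambda,\rho\in K_\infty$ and constants $a,c,\delta>0$, $b\ge0$ with $\rho(s)\ge cs$ for all $s\in[0,\delta]$, such that for all $(\xi,z)\in\mathbb{R}^n\times\mathbb{R}$, $\theta\in\Theta$, $d\in D$: $$\frac{\partial V}{\partial\xi}(\xi,z)f(\xi,z,\theta,d)+\Gamma e^{-z}\frac{\partial V}{\partial z}(\xi,z)\big(V(\xi,z)-\varepsilon\big)^+\le-\rho(V(\xi,z))+\chi(|d|,|\theta|,e^{z}),$$ where $\chi(s_1,s_2,s_3)=a\,\dfrac{s_1^2+\big((s_2-b-\lambda(s_3))^+\big)^2}{1+\kappa(s_3)}$.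 Then there exist $B\in C^0(\mathbb{R}^n\times\mathbb{R}\times\mathbb{R}_+\times\mathbb{R}_+)$, $\gamma\in K_\infty$ and $\sigma\in KL$ such that for every $(\xi_0,z_0)\in\mathbb{R}^n\times\mathbb{R}$, $d\in L^\infty(\mathbb{R}_+;D)$, $\theta\in L^\infty(\mathbb{R}_+;\Theta)$, the unique solution with $(\xi(0),z(0))=(\xi_0,z_0)$ exists for all $t\ge0$, $\lim_{t\to\infty}z(t)$ exists and is finite, and for all $t\ge0$: $$\limsup_{t\to\infty}V(\xi(t),z(t))\le\varepsilon,$$ $$\limsup_{t\to\infty}V(\xi(t),z(t))\le\gamma\Big(\chi\big(\limsup_{t\to\infty}|d(t)|,\ \limsup_{t\to\infty}|\theta(t)|,\ \exp(\lim_{t\to\infty}z(t))\big)\Big),$$ $$V(\xi(t),z(t))\le\sigma(V(\xi_0,z_0),t)+\gamma\big(\chi(\|d\|_\infty,\|\theta\|_\infty,e^{z_0})\big),$$ $$|\xi(t)|\le B(\xi_0,z_0,\|d\|_\infty,\|\theta\|_\infty),\qquad z_0\le z(t)\le\lim_{s\to\infty}z(s)\le B(\xi_0,z_0,\|d\|_\infty,\|\theta\|_\infty).$$ Moreover, if $\rho(s)\ge cs$ for all $s\ge0$, then one may take $\gamma(s)=s/c$ and $\sigma(s,t)=e^{-ct}s$. *)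

(* Defs.v *)
From mathcomp Require Import all_boot all_order all_algebra.
From mathcomp Require Import all_classical all_reals all_analysis.
Import Order.TTheory GRing.Theory Num.Theory.
Import numFieldNormedType.Exports.
Local Open Scope classical_set_scope.
Local Open Scope ring_scope.

Set Implicit Arguments.
Unset Strict Implicit.
Unset Printing Implicit Defensive.

Section Defs.
Context {R : realType}.

Definition enorm (k : nat) (v : 'rV[R]_k) : R :=
  Num.sqrt (\sum_(i < k) v ord0 i ^+ 2).

Definition pos (x : R) : R := Num.max x 0.

Definition classK (al : R -> R) : Prop :=
  {within [set s : R | 0 <= s], continuous al} /\ al 0 = 0 /\
  (forall s t, 0 <= s -> s < t -> al s < al t).

Definition classKinf (al : R -> R) : Prop :=
  classK al /\ (al s @[s --> +oo] --> +oo).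

Definition classKL (sg : R -> R -> R) : Prop :=
  {within [set x : R * R | 0 <= x.1 /\ 0 <= x.2],
      continuous (fun x : R * R => sg x.1 x.2)} /\
  (forall t, 0 <= t -> classK (fun s => sg s t)) /\
  (forall s, 0 <= s ->
     (forall t1 t2, 0 <= t1 -> t1 <= t2 -> sg s t2 <= sg s t1) /\
     (sg s t @[t --> +oo] --> 0)).

Definition ess_sup_from (T : R) (g : R -> R) : R :=
  inf [set M : R | {ae (@lebesgue_measure R), forall t, T <= t -> g t <= M}].

Definition linf_norm (k : nat) (u : R -> 'rV[R]_k) : R :=
  ess_sup_from 0 (fun t => enorm (u t)).

(** essential limsup_{t -> oo} of g (for essentially bounded g) *)
Definition ess_limsup (g : R -> R) : R :=
  inf [set ess_sup_from T g | T in [set T : R | 0 <= T]].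

Definition limsupE (g : R -> R) : \bar R :=
  ereal_inf [set ereal_sup [set (g t)%:E | t in [set t : R | T <= t]]
            | T in [set T : R | 0 <= T]].

Definition Linf (k : nat) (A : set 'rV[R]_k) (u : R -> 'rV[R]_k) : Prop :=
  (forall t, 0 <= t -> A (u t)) /\
  (forall i : 'I_k, measurable_fun [set t : R | 0 <= t] (fun t => u t ord0 i)) /\
  (exists M : R, {ae (@lebesgue_measure R), forall t, 0 <= t -> enorm (u t) <= M}).

Definition zdot (n : nat) (V : 'rV[R]_n * R -> R) (Gam eps : R)
  (xi : 'rV[R]_n) (z : R) : R :=
  Gam * expR (- z) * pos (V (xi, z) - eps).

(** (xi, z) is a (Caratheodory) solution on [0, Tm) of
      xi' = f(xi, z, theta, d),  z' = Gam e^{-z} (V(xi,z) - eps)^+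
    with xi(0) = xi0, z(0) = z0: the right-hand sides are Lebesgue integrable
    on every [0, t], t < Tm, and the integral equations hold. *)
Definition is_solution (n p l : nat)
  (f : 'rV[R]_n -> R -> 'rV[R]_p -> 'rV[R]_l -> 'rV[R]_n)
  (V : 'rV[R]_n * R -> R) (Gam eps : R)
  (theta : R -> 'rV[R]_p) (d : R -> 'rV[R]_l) (xi0 : 'rV[R]_n) (z0 : R)
  (Tm : \bar R) (xi : R -> 'rV[R]_n) (z : R -> R) : Prop :=
  (0 < Tm)%E /\
  forall t : R, 0 <= t -> (t%:E < Tm)%E ->
    (forall i : 'I_n,
       (@lebesgue_measure R).-integrable `[0, t]
          (fun s => (f (xi s) (z s) (theta s) (d s) ord0 i)%:E) /\
       xi t ord0 i = xi0 ord0 i +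
          Rintegral (@lebesgue_measure R) `[0, t]
            (fun s => f (xi s) (z s) (theta s) (d s) ord0 i)) /\
    (@lebesgue_measure R).-integrable `[0, t]
       (fun s => (zdot V Gam eps (xi s) (z s))%:E) /\
    z t = z0 + Rintegral (@lebesgue_measure R) `[0, t]
                 (fun s => zdot V Gam eps (xi s) (z s)).

Definition chi (a b : R) (lam kap : R -> R) (s1 s2 s3 : R) : R :=
  a * (s1 ^+ 2 + (pos (s2 - b - lam s3)) ^+ 2) / (1 + kap s3).

Definition thm8_conclusion (n p l : nat)
  (Th : set 'rV[R]_p) (D : set 'rV[R]_l)
  (f : 'rV[R]_n -> R -> 'rV[R]_p -> 'rV[R]_l -> 'rV[R]_n)
  (V : 'rV[R]_n * R -> R) (Gam eps : R) (ch : R -> R -> R -> R)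
  (B : 'rV[R]_n -> R -> R -> R -> R) (gam : R -> R) (sg : R -> R -> R) : Prop :=
  forall (xi0 : 'rV[R]_n) (z0 : R) (d : R -> 'rV[R]_l) (theta : R -> 'rV[R]_p),
    Linf D d -> Linf Th theta ->
    exists (xi : R -> 'rV[R]_n) (z : R -> R),
      is_solution f V Gam eps theta d xi0 z0 +oo%E xi z /\
      (forall (Tm : \bar R) xi' z', is_solution f V Gam eps theta d xi0 z0 Tm xi' z' ->
         forall t, 0 <= t -> (t%:E < Tm)%E -> xi' t = xi t /\ z' t = z t) /\
      exists zinf : R,
        (z t @[t --> +oo] --> zinf) /\
        (limsupE (fun t => V (xi t, z t)) <= eps%:E)%E /\
        (limsupE (fun t => V (xi t, z t)) <=
           (gam (ch (ess_limsup (fun t => enorm (d t)))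
                    (ess_limsup (fun t => enorm (theta t)))
                    (expR zinf)))%:E)%E /\
        (forall t, 0 <= t ->
           V (xi t, z t) <= sg (V (xi0, z0)) t
                            + gam (ch (linf_norm d) (linf_norm theta) (expR z0))) /\
        (forall t, 0 <= t ->
           enorm (xi t) <= B xi0 z0 (linf_norm d) (linf_norm theta) /\
           z0 <= z t /\ z t <= zinf /\
           zinf <= B xi0 z0 (linf_norm d) (linf_norm theta)).

End Defs.

(* Main.v *)
Require Import Defs.
From mathcomp Require Import all_boot all_order all_algebra.
From mathcomp Require Import all_classical all_reals all_analysis.
From mathcomp Require Import measurable_realfun.
From mathcomp Require Import ring lra.
Import Order.TTheory GRing.Theory Num.Theory.
Import numFieldNormedType.Exports.
Local Open Scope classical_set_scope.
Local Open Scope ring_scope.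

Set Implicit Arguments.
Unset Strict Implicit.
Unset Printing Implicit Defensive.

(** The function [v t = V (xi t, z t)] satisfies [v' <= - rho v + chi] in the sense
    of Dini derivatives, and [chi] can be evaluated at the essential suprema of the
    inputs from any time on, because [z] is nondecreasing and [chi] is nonincreasing
    in [z]. Comparison with [s * exp (- k t) + gam X] gives the decay estimate.
    As [chi] vanishes when [z] tends to infinity, [v] would fall below [eps] in finite
    time if [z] became large, and then [z] stops; this bounds [z], hence [xi] by (i),
    uniformly on bounded sets of data, and a continuous majorant of these bounds is
    [B]. The a priori bounds turn the global Picard solution of a truncated system
    into the solution. Restarting the decay estimate at late times gives the
    asymptotic gain, and convergence of [z] gives [limsup v <= eps]. *)

(** * Comparison by Dini derivatives *)

(** The inputs are only measurable, so [V] along a solution has a classical derivative only almost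
    everywhere. With the inputs replaced by essential suprema, the dissipation inequality bounds the
    upper right Dini derivative at every time, and the scalar comparison is then free of measure
    theory. The obstacle is a circularity: (i) bounds [xi] only where [z] is bounded, while the
    growth of [z] is governed by [V (xi, z)]. It is broken by the decay estimate, which needs no
    bound on the state: it involves only the initial value of [V], the sizes of the inputs and a
    lower bound of [z], and the latter is the initial value. All these bounds hold for every
    solution on every interval [[0, Tm)], hence before existence is known. The linear lower bound of
    [rho] near zero enters twice. It yields a gain in closed form, linear near zero up to a
    continuous factor, and it yields an exponential decay whose rate depends only on the initial
    value. The condition [2 * s <= rho (gam s)] splits [rho v] into two halves: one pays for the
    supply, the other for the decay. *)

Section RealInduction.
Context {R : realType}.
Implicit Types (v y : R -> R).

(** Continuation principle: the supremum of the times up to which [P] holds has the property by the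
    limit hypothesis, and the step hypothesis pushes it further unless it equals [b]. It serves both
    for comparison and for confining the truncated solution to its box. *)
Lemma real_induction (P : R -> Prop) (a b : R) :
  P a ->
  (forall t, a <= t < b -> (forall s, a <= s <= t -> P s) ->
     exists2 h, 0 < h & forall s, t < s < t + h -> P s) ->
  (forall t, a < t <= b -> (forall s, a <= s < t -> P s) -> P t) ->
  forall t, a <= t <= b -> P t.
Proof.
move=> Pa Pstep Plim.
suff H : a <= b -> forall s, a <= s <= b -> P s.
  by move=> t atb; apply: H => //; case/andP: atb => /le_trans; apply.
move=> ab.
pose S := [set t : R | a <= t <= b /\ forall s, a <= s <= t -> P s].
have Sa : S a.
  by split=> [|s sa]; [rewrite lexx | have -> : s = a by apply/eqP; rewrite eq_le andbC].
have Sub : ubound S b by move=> t [/andP[]].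
have hS : has_sup S by split; [exists a | exists b].
have am : a <= sup S by apply: ub_le_sup => //; exists b.
have mb : sup S <= b by apply: ge_sup => //; exists a.
have Plt s : a <= s < sup S -> P s.
  case/andP=> sa sm.
  have [t [_ Pt] st] := @sup_adherent _ S (sup S - s) (ltac:(by rewrite subr_gt0)) hS.
  by apply: Pt; rewrite sa /=; lra.
have Pm : P (sup S).
  have [->//|am'] := eqVneq (sup S) a.
  by apply: Plim => //; rewrite mb lt_neqAle eq_sym am' am.
have Ple s : a <= s <= sup S -> P s.
  case/andP=> sa; rewrite le_eqVlt => /predU1P[->//|sm].
  by apply: Plt; rewrite sa.
have [mEb|mb'] := eqVneq (sup S) b; first by rewrite -mEb.
have mltb : sup S < b by rewrite lt_neqAle mb' mb.
have [h h0 hP] := Pstep _ (introT andP (conj am mltb)) Ple.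
pose t := sup S + Num.min h (b - sup S) / 2.
have mn : 0 < Num.min h (b - sup S) by rewrite lt_min h0 subr_gt0.
have mn1 : Num.min h (b - sup S) <= h by rewrite ge_min lexx.
have mn2 : Num.min h (b - sup S) <= b - sup S by rewrite ge_min lexx orbT.
have St : S t.
  split; first by rewrite /t; apply/andP; split; lra.
  move=> s /andP[sa st]; have [sm|ms] := leP s (sup S).
    by apply: Ple; rewrite sa.
  by apply: hP; rewrite ms /=; move: st; rewrite /t; lra.
have : t <= sup S by apply: ub_le_sup => //; exists b.
by rewrite /t; lra.
Qed.

(** The upper right Dini derivative of [v] at [s] is at most [q], written with a tolerance instead
    of an upper limit. *)
Definition dini_le v (s q : R) : Prop :=
  forall e, 0 < e -> exists2 h, 0 < h &
    forall t, s < t < s + h -> v t - v s <= (q + e) * (t - s).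

(** Lower semicontinuity from the left, which excludes upward jumps: exactly what lets an upper
    bound on [v] pass to a limit from the left. *)
Definition left_lsc v (a b : R) : Prop :=
  forall t, a < t <= b -> forall e, 0 < e -> exists2 h, 0 < h &
    forall s, a <= s -> t - h < s < t -> v t <= v s + e.

(* [y'] is a subgradient of [y], so no derivative of [y] is needed. *)
Lemma dini_comparison v y y' (a b : R) :
  left_lsc v a b -> continuous y ->
  (forall r t, a <= r -> r <= t -> y' r * (t - r) <= y t - y r) ->
  v a <= y a ->
  (forall r, a <= r < b -> exists q, dini_le v r q /\ (v r = y r -> q < y' r)) ->
  forall t, a <= t <= b -> v t <= y t.
Proof.
move=> vl yc yconv vya vD; apply: real_induction => // t.
- move=> /[dup] tab /andP[ta tb] vy.
  have [q [Dq qy]] := vD _ tab.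
  have : v t <= y t by apply: vy; rewrite ta lexx.
  rewrite le_eqVlt => /predU1P[vyt|vyt].
    have qy' := qy vyt.
    (* At a contact the tolerance is the whole gap between [q] and the slope of [y]: then [v] grows
       at most with that slope, while [y] stays above its tangent. *)
    have e0 : 0 < y' t - q by rewrite subr_gt0.
    have [h h0 Dh] := Dq _ e0.
    exists h => // s /andP[ts sth].
    have := Dh s (ltac:(by rewrite ts sth)).
    have := yconv t s ta (ltW ts).
    rewrite vyt (_ : q + (y' t - q) = y' t); last by ring.
    lra.
  have [h h0 Dh] := Dq 1 ltr01.
  (* With tolerance 1 the distance [y - v] closes at rate at most [C], so it survives for a time
     [(y t - v t) / C]; the added 1 keeps [C] positive. *)
  pose C := `|q + 1 - y' t| + 1.
  have C0 : 0 < C by rewrite /C ltr_wpDl.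
  exists (Num.min h ((y t - v t) / C)) => [|s /andP[ts sth]].
    by rewrite lt_min h0 divr_gt0// subr_gt0.
  have s1 : s < t + h.
    by apply: (lt_le_trans sth); rewrite lerD2l ge_min lexx.
  have s2 : C * (s - t) < y t - v t.
    rewrite -ltr_pdivlMl// mulrC ltrBlDl; apply: (lt_le_trans sth).
    by rewrite lerD2l ge_min lexx orbT.
  have := Dh s (ltac:(by rewrite ts s1)).
  have := yconv t s ta (ltW ts).
  have : (q + 1 - y' t) * (s - t) <= C * (s - t).
    apply: ler_wpM2r; first by lra.
    by rewrite /C (le_trans (ler_norm _))// lerDl.
  nra.
- move=> /andP[ta tb] vy; apply/ler_addgt0Pr => e e0.
  have e2 : 0 < e / 2 by rewrite divr_gt0.
  have [h h0 vh] := vl t (ltac:(by rewrite ta tb)) _ e2.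
  have [k /= k0 yk] : nbhs t [set s | `|y t - y s| < e / 2].
    by have /cvgrPdist_lt := yc t; apply.
  pose m := Num.min (Num.min h k) (t - a).
  have m0 : 0 < m by rewrite !lt_min h0 k0 subr_gt0.
  have mh : m <= h by rewrite !ge_min lexx.
  have mk : m <= k by rewrite !ge_min lexx orbT.
  have ma : m <= t - a by rewrite !ge_min lexx orbT.
  pose s := t - m / 2.
  have vs := vh s (ltac:(rewrite /s; lra)) (ltac:(rewrite /s; apply/andP; split; lra)).
  have ys : `|y t - y s| < e / 2.
    apply: yk => /=; rewrite /ball_ /s opprB addrC subrK gtr0_norm; lra.
  have vys : v s <= y s by apply: vy; rewrite /s; apply/andP; split; lra.
  move: ys; rewrite ltr_norml => /andP[ys1 ys2]; lra.
Qed.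

Lemma left_lscW v (a b a' b' : R) : a <= a' -> b' <= b ->
  left_lsc v a b -> left_lsc v a' b'.
Proof.
move=> aa bb H t /andP[t1 t2] e e0.
have [h h0 hP] := H t (ltac:(by rewrite (le_lt_trans aa t1) (le_trans t2 bb))) e e0.
by exists h => // s sa; apply: hP; exact: le_trans sa.
Qed.

(** Tangent-line inequality, from [1 + x <= expR x]; it is the subgradient hypothesis of
    [dini_comparison] for decaying exponentials. *)
Lemma expR_convex (k A B a r t : R) : 0 <= A ->
  - k * (A * expR (- (k * (r - a)))) * (t - r) <=
  (A * expR (- (k * (t - a))) + B) - (A * expR (- (k * (r - a))) + B).
Proof.
move=> A0.
have -> : - (k * (t - a)) = - (k * (r - a)) + (- (k * (t - r))) by ring.
rewrite expRD.
have H := expR_ge1Dx (- (k * (t - r))).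
have E0 : 0 <= A * expR (- (k * (r - a))) by rewrite mulr_ge0// expR_ge0.
have := ler_wpM2l E0 H; nra.
Qed.

Lemma continuous_expR_affine (k A B a : R) :
  continuous (fun t : R => A * expR (- (k * (t - a))) + B).
Proof.
move=> t; apply: cvgD; last exact: cvg_cst.
apply: cvgM; first exact: cvg_cst.
apply: continuous_comp; last exact: continuous_expR.
apply: cvgN; apply: cvgM; first exact: cvg_cst.
by apply: cvgB; [exact: cvg_id | exact: cvg_cst].
Qed.

Lemma dini_le_linear_bound v (a b C : R) :
  left_lsc v a b -> (forall r, a <= r < b -> exists2 q, dini_le v r q & q <= C) ->
  forall t, a <= t <= b -> v t <= v a + C * (t - a).
Proof.
move=> vl vD t tab; apply/ler_addgt0Pr => e e0.
have ta : 0 <= t - a by case/andP: tab => *; lra.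
(* Comparison requires a strict inequality at contact, so the slope is raised by [e'], chosen so
   that the total excess at time [t] is at most [e]. *)
pose e' := e / (t - a + 1).
have e'0 : 0 < e' by rewrite divr_gt0//; lra.
have : v t <= v a + (C + e') * (t - a).
  apply: (@dini_comparison v (fun t => v a + (C + e') * (t - a)) (fun=> C + e') a b) => //.
  - move=> x; apply: cvgD; first exact: cvg_cst.
    by apply: cvgM; [exact: cvg_cst | apply: cvgB; [exact: cvg_id|exact: cvg_cst]].
  - by move=> r s _ _; nra.
  - by rewrite subrr mulr0 addr0.
  - by move=> r /vD[q Dq qC]; exists q; split => // _; lra.
move=> /le_trans; apply.
have : e' * (t - a) <= e.
  rewrite /e' mulrAC ler_pdivrMr; last by lra.
  by rewrite ler_wpM2l; lra.
nra.
Qed.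

End RealInduction.

(** * Comparison functions *)

Section Majorant.
Context {R : realType}.

(** A locally finite sum of the [|g i|] weighted by ramps. The margin in [k <= x + 1] lets the
    integer just above [x] serve as the index. It turns integer-indexed bounds into continuous ones,
    for the gain and for [B]. *)
Lemma continuous_majorant (g : nat -> R) : exists H : R -> R,
  [/\ continuous H, {homo H : x y / x <= y}, forall x, 0 <= H x &
      forall k x, k%:R <= x + 1 -> g k <= H x].
Proof.
(* Zero for [x <= i - 2] and one for [x >= i - 1]. *)
pose ramp (i : nat) (x : R) := Num.max 0 (Num.min 1 (x + 2 - i%:R)).
have ramp_ge0 i x : 0 <= ramp i x by rewrite /ramp le_max lexx.
have ramp_c i : continuous (ramp i).
  move=> x.
  have c1 : {for x, continuous (fun x : R => x + 2 - i%:R : R^o)}.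
    apply: cvgD; last exact: cvg_cst.
    by apply: cvgD; [exact: cvg_id | exact: cvg_cst].
  have c2 := continuous_min (@cst_continuous R R^o 1 x) c1.
  exact: continuous_max (@cst_continuous R R^o 0 x) c2.
have ramp_h i : {homo ramp i : x y / x <= y}.
  move=> x y xy; rewrite /ramp ge_max le_max lexx /=.
  rewrite le_max; apply/orP; right; rewrite le_min ge_min lexx /=.
  by rewrite ge_min; apply/orP; right; rewrite !lerD2r.
pose S N (x : R) := \sum_(i < N) `|g i| * ramp i x.
have S_ext N N' x : (N <= N')%N -> x + 2 <= N%:R -> S N' x = S N x.
  move=> NN xN; rewrite /S -(subnKC NN) big_split_ord /= [X in _ + X]big1 ?addr0//.
  move=> i _; rewrite /ramp /= max_l ?mulr0// ge_min; apply/orP; right.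
  rewrite natrD; have : 0 <= i%:R :> R by []; lra.
(* Terms of index at least [x + 2] vanish; reaching [x + 3] makes the same finite sum valid for all
   arguments below [x + 1], hence near [x]. *)
pose Nf (x : R) := (Num.trunc `|x|).+4.
have Nf_gt x : x + 3 <= (Nf x)%:R.
  rewrite /Nf; have := truncnS_gt `|x|; rewrite -[(Num.trunc _).+4]addn3 natrD.
  by rewrite -addn1 natrD; have := ler_norm x; lra.
pose H x := S (Nf x) x.
have HS N x : x + 2 <= N%:R -> H x = S N x.
  move=> xN; rewrite /H; have [NN|NN] := leqP (Nf x) N.
    by rewrite (S_ext _ _ _ NN)//; have := Nf_gt x; lra.
  by rewrite (S_ext _ _ _ (ltnW NN)).
have S_c N : continuous (S N).
  elim: N => [|N IH] x.
    have -> : S 0%N = fun=> 0 by apply/funext => y; rewrite /S big_ord0.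
    exact: cvg_cst.
  have -> : S N.+1 = fun y => S N y + `|g N| * ramp N y.
    by apply/funext => y; rewrite /S big_ord_recr.
  apply: cvgD; first exact: IH.
  by apply: cvgM; [exact: cvg_cst | exact: ramp_c].
exists H; split.
- move=> x; rewrite /continuous_at (HS (Nf x) x); last by have := Nf_gt x; lra.
  apply: cvg_trans (S_c (Nf x) x); apply: near_eq_cvg; near=> y.
  rewrite (HS (Nf x) y)//.
  have : y < x + 1 by near: y; apply: lt_nbhsl; rewrite ltrDl.
  by have := Nf_gt x; lra.
- move=> x y xy; have yN := Nf_gt y.
  rewrite (HS (Nf y) x) ?(HS (Nf y) y); try lra.
  by apply: ler_sum => i _; rewrite ler_wpM2l// ramp_h.
- by move=> x; rewrite /H /S; apply: sumr_ge0 => i _; rewrite mulr_ge0.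
- move=> k x kx.
  have kN : (k < Nf x)%N.
    by rewrite -(ltr_nat R); have := Nf_gt x; lra.
  rewrite /H /S (bigD1 (Ordinal kN)) //=.
  have -> : ramp k x = 1 by rewrite /ramp min_l ?max_r//; lra.
  rewrite mulr1 ler_wpDr ?ler_norm//; apply: sumr_ge0 => i _.
  by rewrite mulr_ge0.
Unshelve. all: by end_near. Qed.

End Majorant.

(** * Decay of scalar functions under a constant supply *)

Section DecayEstimates.
Context {R : realType}.
Implicit Types (rho gam : R -> R) (sg : R -> R -> R).

Lemma classK_mono rho : classK rho -> forall s t, 0 <= s -> s <= t -> rho s <= rho t.
Proof.
move=> [_ [_ h]] s t s0; rewrite le_eqVlt => /predU1P[->//|st].
exact/ltW/h.
Qed.

Lemma classK_ge0 rho : classK rho -> forall s, 0 <= s -> 0 <= rho s.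
Proof.
by move=> h s s0; rewrite -(proj1 (proj2 h)); exact: classK_mono.
Qed.

Lemma classKinf_unbounded rho : classKinf rho -> forall M : R,
  exists r, 0 <= r /\ M <= rho r.
Proof.
move=> [_ /cvgryPge h] M; have [N [_ HN]] := h M.
exists (Num.max 0 (N + 1)); split; first by rewrite le_max lexx.
by apply: HN; rewrite lt_max ltrDl ltr01 orbT.
Qed.

(** Separates the scalar comparison from the system, so that one treatment of trajectories serves
    both choices of [gam] and [sg]. Here [X] is a constant bound on the supply. *)
Definition decay_estimate rho gam sg : Prop :=
  forall (v : R -> R) (a b X : R), 0 <= X ->
    (forall t, a <= t <= b -> 0 <= v t) ->
    left_lsc v a b ->
    (forall r, a <= r < b -> dini_le v r (X - rho (v r))) ->
    forall t, a <= t <= b -> v t <= sg (v a) (t - a) + gam X.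

(** The comparison function solves [y' = - c * y + X + c * e]; the excess [c * e] gives strictness
    at contact, and [e] is arbitrary. *)
Lemma linear_decay_estimate rho (c : R) : 0 < c ->
  (forall s, 0 <= s -> c * s <= rho s) ->
  decay_estimate rho (fun s => s / c) (fun s t => expR (- (c * t)) * s).
Proof.
move=> c0 hc v a b X X0 v0 vl vD t tab.
have va : 0 <= v a by apply: v0; rewrite lexx; case/andP: tab => /le_trans; apply.
apply/ler_addgt0Pr => e e0.
rewrite mulrC -addrA.
pose y t := v a * expR (- (c * (t - a))) + (X / c + e).
apply: (@dini_comparison _ v y (fun r => - c * (v a * expR (- (c * (r - a))))) a b) => //.
- exact: continuous_expR_affine.
- by move=> r s _ _; exact: expR_convex.
- rewrite /y subrr mulr0 oppr0 expR0 mulr1 lerDl addr_ge0 ?(ltW e0)//.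
  by rewrite divr_ge0// ltW.
- move=> r rab; exists (X - rho (v r)); split; first exact: vD.
  move=> vy; have vr : 0 <= v r by apply: v0; case/andP: rab => -> /ltW.
  have H := hc _ vr.
  have -> : v a * expR (- (c * (r - a))) = v r - X / c - e.
    by rewrite vy /y; ring.
  have -> : - c * (v r - X / c - e) = X - c * v r + c * e.
    by field; rewrite gt_eqF.
  have : 0 < c * e by rewrite mulr_gt0.
  lra.
Qed.

(* At a contact [v = gam X + r] one has [rho v >= 2 X] and [rho v >= rho r], so
   [v' <= - rho r / 2 <= - (c / 2) min (r, delta)]; the rate in [sg] is the slope
   of a linear minorant of [min (r, delta)] on [0, v a + 1]. *)
Lemma Kinf_decay_estimate rho (c delta : R) : classKinf rho -> 0 < c -> 0 < delta ->
  (forall s, 0 <= s <= delta -> c * s <= rho s) ->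
  forall gam, (forall s, 0 <= s -> 0 <= gam s /\ 2 * s <= rho (gam s)) ->
  decay_estimate rho gam
    (fun s t => s * expR (- (c * delta / 2 / (delta + 1 + s) * t))).
Proof.
move=> hrho c0 d0 hc gam hgam v a b X X0 v0 vl vD t tab.
have hK : classK rho by case: hrho.
have va : 0 <= v a by apply: v0; rewrite lexx; case/andP: tab => /le_trans; apply.
apply/ler_addgt0Pr => e e0.
(* The cap 1 keeps [w + e1] below [v a + 1], the range for which the rate [k] is computed. *)
pose e1 := Num.min e 1.
have e10 : 0 < e1 by rewrite /e1 lt_min e0 ltr01.
have e1e : e1 <= e by rewrite /e1 ge_min lexx.
have e11 : e1 <= 1 by rewrite /e1 ge_min lexx orbT.
have [g0 g2] := hgam _ X0.
pose k := c * delta / 2 / (delta + 1 + v a).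
have dv : 0 < delta + 1 + v a by lra.
have k0 : 0 < k by rewrite /k !divr_gt0// mulr_gt0.
suff : v t <= v a * expR (- (k * (t - a))) + (gam X + e1) by rewrite -/k; lra.
pose y t := v a * expR (- (k * (t - a))) + (gam X + e1).
apply: (@dini_comparison _ v y (fun r => - k * (v a * expR (- (k * (r - a))))) a b) => //.
- exact: continuous_expR_affine.
- by move=> r s _ _; exact: expR_convex.
- by rewrite /y subrr mulr0 oppr0 expR0 mulr1 lerDl; lra.
- move=> r rab; exists (X - rho (v r)); split; first exact: vD.
  move=> vy; have vr : 0 <= v r by apply: v0; case/andP: rab => -> /ltW.
  have ra : 0 <= r - a by case/andP: rab => *; lra.
  pose w := v a * expR (- (k * (r - a))).
  have w0 : 0 <= w by rewrite mulr_ge0// expR_ge0.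
  have wv : w <= v a.
    by rewrite /w ler_piMr// -expR0 ler_expR oppr_le0 mulr_ge0// ltW.
  have vE : v r = gam X + (w + e1) by rewrite vy /y -/w; ring.
  have we : 0 < w + e1 by lra.
  have r1 : 2 * X <= rho (v r).
    by apply: (le_trans g2); apply: classK_mono => //; rewrite vE; lra.
  have r2 : rho (w + e1) <= rho (v r).
    by apply: classK_mono => //; [exact: ltW | rewrite vE; lra].
  (* The scaled argument lies below [delta], so the linear bound applies to it, and below [w + e1],
     so monotonicity of [rho] finishes. *)
  have r3 : c * delta / (delta + 1 + v a) * (w + e1) <= rho (w + e1).
    have q1 : delta / (delta + 1 + v a) * (w + e1) <= delta.
      rewrite mulrAC ler_pdivrMr// ler_pM2l//; lra.
    have q2 : delta / (delta + 1 + v a) * (w + e1) <= w + e1.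
      by rewrite ler_piMl ?(ltW we)// ler_pdivrMr//; lra.
    have q0 : 0 <= delta / (delta + 1 + v a) * (w + e1).
      by rewrite mulr_ge0 ?(ltW we)// divr_ge0 ?ltW.
    have := hc _ (introT andP (conj q0 q1)).
    rewrite !mulrA => /le_trans; apply.
    rewrite -!mulrA [_ * (w + e1)]mulrC mulrA in q2 q0 *.
    exact: classK_mono.
  have kE : c * delta / (delta + 1 + v a) = 2 * k.
    by rewrite /k; field; rewrite gt_eqF.
  rewrite kE in r3.
  have : 0 < k * e1 by rewrite mulr_gt0.
  rewrite -/w; nra.
Qed.

End DecayEstimates.

(** * Construction of the gain and membership in the comparison classes *)

Section GainsK.
Context {R : realType}.

Lemma expR_decay_cvg0 (q A : R) : 0 < q -> A * expR (- (q * t)) @[t --> +oo] --> (0 : R).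
Proof.
move=> q0; rewrite -[X in _ --> X](mulr0 A); apply: cvgM; first exact: cvg_cst.
apply/cvgrPdist_lt => e e0; near=> t.
rewrite sub0r normrN gtr0_norm ?expR_gt0// -[ltRHS]lnK// ltr_expR.
rewrite ltrNl -ltr_pdivrMl//.
by near: t; apply: nbhs_pinfty_gt; rewrite num_real.
Unshelve. all: by end_near. Qed.

(** A closed-form substitute for the inverse of [rho / 2]. While [2 * s / c <= delta], the linear
    bound alone suffices; beyond that, the factor [1 + H s] lifts the value above a point [r k]
    where [rho] is at least [2 * k]. *)
Lemma Kinf_gain_exists (rho : R -> R) (c delta : R) : classKinf rho ->
  0 < c -> 0 < delta -> (forall s, 0 <= s <= delta -> c * s <= rho s) ->
  exists gam : R -> R, classKinf gam /\
    forall s, 0 <= s -> 0 <= gam s /\ 2 * s <= rho (gam s).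
Proof.
move=> hrho c0 d0 hc; have hK : classK rho by case: hrho.
have [r hr] := choice (fun k : nat => classKinf_unbounded hrho (2 * k%:R)).
have [H [Hc Hm H0 Hg]] := continuous_majorant (fun k => r k / delta).
pose gam s := (2 * s / c) * (1 + H s).
have gc : continuous gam.
  move=> s; apply: cvgM.
    by apply: cvgM; [apply: cvgM; [exact: cvg_cst|exact: cvg_id]|exact: cvg_cst].
  by apply: cvgD; [exact: cvg_cst|exact: Hc].
exists gam; split; [split; [split|]|].
- by apply: continuous_subspaceT.
- split; first by rewrite /gam mulr0 mul0r mul0r.
  move=> s t s0 st; rewrite /gam.
  have H1 : 1 + H s <= 1 + H t by rewrite lerD2l Hm// ltW.
  have H2 : 0 < 1 + H s by have := H0 s; lra.
  have H3 : 2 * s / c < 2 * t / c by rewrite ltr_pM2r ?invr_gt0//; lra.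
  apply: (lt_le_trans (y := 2 * t / c * (1 + H s))); first by rewrite ltr_pM2r.
  by rewrite ler_wpM2l// divr_ge0 ?(ltW c0)//; lra.
- apply/cvgryPge => A; near=> s.
  have s0 : 0 <= s by near: s; apply: nbhs_pinfty_ge; rewrite num_real.
  have s1 : A * c / 2 <= s by near: s; apply: nbhs_pinfty_ge; rewrite num_real.
  have : A <= 2 * s / c by rewrite ler_pdivlMr//; lra.
  move=> /le_trans; apply; rewrite /gam ler_peMr//; last by have := H0 s; lra.
  by rewrite divr_ge0 ?(ltW c0)//; lra.
- move=> s s0.
  have g0 : 0 <= 2 * s / c by rewrite divr_ge0 ?(ltW c0)//; lra.
  have g1 : 2 * s / c <= gam s by rewrite /gam ler_peMr//; have := H0 s; lra.
  split; first exact: le_trans g1.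
  have [sd|sd] := leP (2 * s / c) delta.
    have h1 := hc _ (introT andP (conj g0 sd)).
    have -> : 2 * s = c * (2 * s / c) by field; rewrite gt_eqF.
    by apply: (le_trans h1); exact: classK_mono.
  (* The integer with [s < k <= s + 1]: the left inequality gives [2 * s <= rho (r k)], the right
     one lies within the margin of [H]. *)
  pose k := (Num.trunc s).+1.
  have /andP[ks1 ks2] := truncn_itv s0.
  have := Hg k s; rewrite /k -addn1 natrD lerD2r => /(_ ks1) hk.
  have [r0 r1] := hr k.
  apply: (@le_trans _ _ (rho (r k))).
    by apply: le_trans r1; rewrite ler_pM2l//; exact: ltW.
  apply: classK_mono => //.
  move: hk; rewrite addn1 ler_pdivrMr// => /le_trans; apply.
  rewrite /gam; have := H0 s; nra.
Unshelve. all: by end_near. Qed.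

Lemma classKinf_linear (c : R) : 0 < c -> classKinf (fun s : R => s / c).
Proof.
move=> c0; split; [split; [|split]|].
- apply: continuous_subspaceT => x; apply: cvgM; [exact: cvg_id|exact: cvg_cst].
- by rewrite mul0r.
- by move=> s t _ st; rewrite ltr_pM2r// invr_gt0.
- apply/cvgryPge => A; near=> s.
  have : A * c <= s by near: s; apply: nbhs_pinfty_ge; rewrite num_real.
  by rewrite ler_pdivlMr.
Unshelve. all: by end_near. Qed.

(** Increasing in [s] because the rate [k / (A + s)] decreases: a larger initial value also decays
    more slowly. *)
Lemma classKL_expR_decay (k A : R) : 0 < k -> 0 < A ->
  classKL (fun s t : R => s * expR (- (k / (A + s) * t))).
Proof.
move=> k0 A0; split; [|split].
- apply: continuous_in_subspaceT => -[s t]; rewrite inE /= => -[s0 t0].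
  have As : A + s != 0 by rewrite gt_eqF// ltr_wpDr.
  apply: cvgM; first exact: cvg_fst.
  apply: (@continuous_comp _ _ _ (fun x : R * R => - (k / (A + x.1) * x.2)));
    last exact: continuous_expR.
  apply: cvgN; apply: cvgM; last exact: cvg_snd.
  apply: cvgM; first exact: cvg_cst.
  apply: cvgV => //=; apply: cvgD; [exact: cvg_cst | exact: cvg_fst].
- move=> t t0; split; [|split].
  + apply: continuous_in_subspaceT => s; rewrite inE /= => s0.
    have As : A + s != 0 by rewrite gt_eqF// ltr_wpDr.
    apply: cvgM; first exact: cvg_id.
    apply: (@continuous_comp _ _ _ (fun x : R => - (k / (A + x) * t)));
      last exact: continuous_expR.
    apply: cvgN; apply: cvgM; last exact: cvg_cst.
    apply: cvgM; first exact: cvg_cst.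
    apply: cvgV => //=; apply: cvgD; [exact: cvg_cst | exact: cvg_id].
  + by rewrite mul0r.
  + move=> s s' s0 ss.
    have s'0 : 0 < s' by exact: le_lt_trans ss.
    apply: (@lt_le_trans _ _ (s' * expR (- (k / (A + s) * t)))).
      by rewrite ltr_pM2r// expR_gt0.
    rewrite ler_pM2l// ler_expR lerN2 ler_wpM2r// ler_pM2l// lef_pV2 ?posrE; lra.
- move=> s s0; have As : 0 < k / (A + s) by rewrite divr_gt0// ltr_wpDr.
  split; last exact: expR_decay_cvg0.
  move=> t1 t2 t10 t12; rewrite ler_wpM2l// ler_expR lerN2.
  by apply: ler_wpM2l => //; exact: ltW.
Qed.

Lemma classKL_expR_linear (c : R) : 0 < c ->
  classKL (fun s t : R => expR (- (c * t)) * s).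
Proof.
move=> c0.
have cE : continuous (fun t : R => expR (- (c * t))).
  move=> t; apply: continuous_comp; last exact: continuous_expR.
  by apply: cvgN; apply: cvgM; [exact: cvg_cst|exact: cvg_id].
split; [|split].
- apply: continuous_subspaceT => -[s t]; apply: cvgM; last exact: cvg_fst.
  apply: (@continuous_comp _ _ _ (fun x : R * R => x.2) (fun t => expR (- (c * t)))).
    exact: cvg_snd.
  exact: cE.
- move=> t t0; split; [|split].
  + by apply: continuous_subspaceT => s; apply: cvgM; [exact: cvg_cst|exact: cvg_id].
  + by rewrite mulr0.
  + by move=> s s' s0 ss; rewrite ltr_pM2l// expR_gt0.
- move=> s s0; split.
    by move=> t1 t2 _ t12; rewrite ler_wpM2r// ler_expR lerN2 ler_pM2l.
  under eq_fun do rewrite mulrC.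
  exact: expR_decay_cvg0.
Qed.

End GainsK.

(** * Caratheodory equations *)

Section RowNorm.
Context {R : realType}.

Lemma rV_norm_ge_entry n (x : 'rV[R]_n) i : `|x ord0 i| <= `|x|.
Proof.
rewrite (_ : `|x| = mx_norm x)// mx_normrE.
by apply: (@le_bigmax _ _ _ 0 (fun ij : 'I_1 * 'I_n => `|x ij.1 ij.2|) (ord0, i)).
Qed.

Lemma rV_norm_le n (x : 'rV[R]_n) (c : R) : 0 <= c ->
  (forall i, `|x ord0 i| <= c) -> `|x| <= c.
Proof.
move=> c0 h; rewrite (_ : `|x| = mx_norm x)// mx_normrE.
by apply/bigmax_leP; split => // -[i j] _ /=; rewrite [i]ord1.
Qed.

Lemma entry_continuous n (i : 'I_n) : continuous (fun x : 'rV[R]_n => x ord0 i).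
Proof. by move=> x; exact: coord_continuous. Qed.

End RowNorm.

(** * Integrals over intervals with almost everywhere bounds *)

Section Integrals.
Context {R : realType}.
Notation mu := (@lebesgue_measure R).
Implicit Types (f g h : R -> R) (a b s t : R).

Lemma ae_sub (P Q : R -> Prop) : (forall x, P x -> Q x) ->
  {ae mu, forall x, P x} -> {ae mu, forall x, Q x}.
Proof.
move=> PQ [N [mN N0 sN]]; exists N; split => // x nQ; apply: sN => Px.
exact/nQ/PQ.
Qed.

Lemma ae_and (P Q : R -> Prop) :
  {ae mu, forall x, P x} -> {ae mu, forall x, Q x} -> {ae mu, forall x, P x /\ Q x}.
Proof.
move=> [N [mN N0 sN]] [M [mM M0 sM]]; exists (N `|` M); split.
- exact: measurableU.
- exact: null_set_setU.
- move=> x /not_andP[nP|nQ]; [left; exact: sN | right; exact: sM].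
Qed.

(** Removing the exceptional null set from the domain changes neither integral and leaves a
    pointwise comparison. *)
Lemma ae_le_Rintegral (D : set (measurableTypeR R)) f g : measurable D ->
  mu.-integrable D (EFin \o f) -> mu.-integrable D (EFin \o g) ->
  {ae mu, forall x, D x -> f x <= g x} ->
  Rintegral mu D f <= Rintegral mu D g.
Proof.
move=> mD If Ig [N [mN N0 sN]].
have E h : mu.-integrable D (EFin \o h) -> Rintegral mu D h = Rintegral mu (D `\` N) h.
  move=> Ih; rewrite /Rintegral; congr fine.
  exact: negligible_integral.
rewrite (E _ If) (E _ Ig).
have mDN : measurable (D `\` N) by exact: measurableD.
apply: le_Rintegral => //.
- exact: (integrableS mD mDN (@subDsetl _ _ _) If).
- exact: (integrableS mD mDN (@subDsetl _ _ _) Ig).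
by move=> x [Dx Nx]; apply: contrapT => xfg; apply: Nx; apply: sN => /= /(_ Dx).
Qed.

Lemma ae_bounded_integrable a b f (M : R) :
  measurable_fun (`[a, b]%classic : set (measurableTypeR R)) f ->
  {ae mu, forall x, `[a, b]%classic x -> `|f x| <= M} ->
  mu.-integrable `[a, b] (EFin \o f).
Proof.
move=> mf fM; apply/integrableP; split; first exact/measurable_EFinP.
have muf : (mu `[a, b] < +oo)%E.
  by rewrite lebesgue_measure_itv /=; case: ifP => // _; rewrite -EFinD ltry.
apply: le_lt_trans.
  apply: (integral_le_bound (`|M| + 1)%:E) => //.
  - exact/measurable_EFinP.
  - apply: ae_sub fM => x fM /fM {}fM /=; rewrite lee_fin (le_trans fM)//.
    by rewrite (le_trans (ler_norm _))// lerDl.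
by rewrite lte_mul_pinfty// lee_fin addr_ge0.
Qed.

Lemma Rintegral_split s t g : 0 <= s -> s <= t ->
  mu.-integrable `[0, t] (EFin \o g) ->
  Rintegral mu `[0, t] g - Rintegral mu `[0, s] g = Rintegral mu `[s, t] g.
Proof.
move=> s0 st Ig; rewrite (Rintegral_itvB (x := s) Ig) ?bnd_simp//.
rewrite Rintegral_itv_obnd_cbnd//.
apply: integrableS Ig => //; apply: subset_itvr; rewrite bnd_simp//.
Qed.

Lemma integrable_sub_itv s t g : 0 <= s ->
  mu.-integrable `[0, t] (EFin \o g) -> mu.-integrable `[s, t] (EFin \o g).
Proof.
by move=> s0; apply: integrableS => //; apply: subset_itvr; rewrite bnd_simp.
Qed.

Lemma integrable_cst_itv s t (A : R) : mu.-integrable `[s, t] (EFin \o fun=> A).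
Proof.
apply: (@ae_bounded_integrable _ _ _ `|A|); first exact: measurable_cst.
by apply: aeW => x _.
Qed.

Lemma Rintegral_cst_itv s t (A : R) : s <= t ->
  Rintegral mu `[s, t] (fun=> A) = A * (t - s).
Proof.
move=> st; rewrite Rintegral_cst//=.
rewrite [fine _](_ : _ = t - s)// lebesgue_measure_itv /=.
case: ifPn; rewrite lte_fin // -leNgt => ts.
by rewrite (le_anti (introT andP (conj st ts))) subrr.
Qed.

Lemma Rintegral_le_ae s t g (A : R) : s <= t -> mu.-integrable `[s, t] (EFin \o g) ->
  {ae mu, forall x, s <= x <= t -> g x <= A} ->
  Rintegral mu `[s, t] g <= A * (t - s).
Proof.
move=> st Ig gA; rewrite -Rintegral_cst_itv//; apply: ae_le_Rintegral => //.
exact: integrable_cst_itv.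
Qed.

Lemma Rintegral_norm_le_ae s t g (A : R) : s <= t ->
  mu.-integrable `[s, t] (EFin \o g) ->
  {ae mu, forall x, s <= x <= t -> `|g x| <= A} ->
  `|Rintegral mu `[s, t] g| <= A * (t - s).
Proof.
move=> st Ig gA.
apply: (le_trans (le_normr_Rintegral _ Ig)) => //.
by apply: Rintegral_le_ae => //; exact: integrable_norm.
Qed.

Lemma Rintegral_expR (L t : R) : 0 < L -> 0 <= t ->
  Rintegral mu `[0, t] (fun s => L * expR (2 * L * s)) = (expR (2 * L * t) - 1) / 2.
Proof.
move=> L0; rewrite le_eqVlt => /predU1P[<-|t0].
  by rewrite set_itv1 Rintegral_set1 mulr0 expR0 subrr mul0r.
have dE (x : R) : is_derive x 1 (fun s => expR (2 * L * s) / 2) (L * expR (2 * L * x)).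
  have -> : (fun s => expR (2 * L * s) / 2) = (2^-1 : R) \*: (expR \o ((2 * L) \*: (@id R))).
    by apply/funext => s /=; rewrite mulrC.
  by apply: is_derive_eq; rewrite /GRing.scale /=; field.
have cE : continuous (fun s : R => expR (2 * L * s)).
  move=> s; apply: continuous_comp; last exact: continuous_expR.
  by apply: cvgM; [exact: cvg_cst|exact: cvg_id].
have c1 : {within `[0, t], continuous (fun s => L * expR (2 * L * s))}.
  by apply: continuous_subspaceT; move=> u; apply: cvgM; [exact: cvg_cst|exact: cE].
have c2 : derivable_oo_LRcontinuous (fun s => expR (2 * L * s) / 2) 0 t.
  split.
  + by move=> u _; case: (dE u).
  + by apply: cvg_at_right_filter; apply: cvgM; [exact: cE|exact: cvg_cst].
  + by apply: cvg_at_left_filter; apply: cvgM; [exact: cE|exact: cvg_cst].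
have c3 : {in `]0, t[, derive1 (fun s : R => expR (2 * L * s) / 2 : R) =1
    (fun s => L * expR (2 * L * s))}.
  by move=> u _; rewrite derive1E; case: (dE u).
apply: (etrans (congr1 fine (continuous_FTC2 t0 c1 c2 c3))).
by rewrite /= mulr0 expR0 mulrBl.
Qed.

(* With the weight [expR (2 * L * s)], integration of an [L]-Lipschitz
   right-hand side halves distances on every interval [0, t]. *)
Lemma Rintegral_weighted_contraction (L C t : R) g h : 0 < L -> 0 <= C -> 0 <= t ->
  mu.-integrable `[0, t] (EFin \o g) -> mu.-integrable `[0, t] (EFin \o h) ->
  {ae mu, forall s, 0 <= s <= t -> `|g s - h s| <= L * (C * expR (2 * L * s))} ->
  `|Rintegral mu `[0, t] g - Rintegral mu `[0, t] h| <= C / 2 * expR (2 * L * t).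
Proof.
move=> L0 C0 t0 Ig Ih gh.
have Iw : mu.-integrable `[0, t] (EFin \o (fun s => L * expR (2 * L * s))).
  apply: continuous_compact_integrable; first exact: segment_compact.
  apply: continuous_subspaceT; move=> u; apply: cvgM; first exact: cvg_cst.
  apply: continuous_comp; last exact: continuous_expR.
  by apply: cvgM; [exact: cvg_cst|exact: cvg_id].
have Id : mu.-integrable `[0, t] (EFin \o (fun s => g s - h s)).
  exact: (integrableB _ Ig Ih).
rewrite -RintegralB//; apply: (le_trans (le_normr_Rintegral _ Id)) => //.
apply: (@le_trans _ _ (Rintegral mu `[0, t] (fun s => C * (L * expR (2 * L * s))))).
  apply: ae_le_Rintegral => //; first exact: integrable_norm.
    exact: (integrableZl _ C Iw).
  apply: ae_sub gh => s h1 s0t; rewrite mulrCA; apply: h1.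
  by move: s0t; rewrite /= in_itv.
rewrite RintegralZl// Rintegral_expR//; nra.
Qed.

End Integrals.

Section GeometricLimit.
Context {R : realType}.

Lemma le0_of_geometric (x A : R) : (forall k : nat, x <= A / 2 ^+ k) -> x <= 0.
Proof.
move=> h; apply/ler_addgt0Pr => e e0; rewrite add0r.
pose k := (Num.trunc (`|A| / e)).+1.
have Ak : `|A| / e < 2 ^+ k.
  apply: (lt_le_trans (truncnS_gt _)); rewrite -natrX ler_nat.
  exact/ltnW/ltn_expl.
apply: (le_trans (h k)); rewrite ler_pdivrMr ?exprn_gt0//.
rewrite ltr_pdivrMr// in Ak; rewrite mulrC; apply: ltW; apply: le_lt_trans Ak.
exact: ler_norm.
Qed.

(** Nested intervals: all later terms stay within [2 * C / 2 ^+ k] of [a k], so each lower end is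
    below each upper end, and the supremum of the lower ends is the limit, with an explicit
    error. *)
Lemma geometric_cauchy_limit (a : nat -> R) (C : R) : 0 <= C ->
  (forall k, `|a k.+1 - a k| <= C / 2 ^+ k) ->
  exists l, forall k, `|a k - l| <= 2 * C / 2 ^+ k.
Proof.
move=> C0 ha.
(* The subtracted remainder is what makes the induction on [j] close. *)
have tail k j : `|a (k + j)%N - a k| <= 2 * C / 2 ^+ k - 2 * C / 2 ^+ (k + j).
  elim: j => [|j IH]; first by rewrite addn0 !subrr normr0.
  rewrite addnS; have := ha (k + j)%N; set u := a _; set w := a (k + j)%N in IH *.
  move=> h; have -> : u - a k = (u - w) + (w - a k) by ring.
  apply: (le_trans (ler_normD _ _)); apply: (le_trans (lerD h IH)).
  rewrite [2 ^+ (k + j).+1]exprS.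
  have p0 : 2 ^+ (k + j) != 0 :> R by rewrite expf_neq0.
  have -> : 2 * C / (2 * 2 ^+ (k + j)) = C / 2 ^+ (k + j) by field.
  lra.
have up k j : a (k + j)%N <= a k + 2 * C / 2 ^+ k.
  have := tail k j; rewrite ler_norml => /andP[_].
  have : 0 <= 2 * C / 2 ^+ (k + j) by rewrite divr_ge0 ?exprn_ge0//; lra.
  lra.
have lo k j : a k - 2 * C / 2 ^+ k <= a (k + j)%N.
  have := tail k j; rewrite ler_norml => /andP[+ _].
  have : 0 <= 2 * C / 2 ^+ (k + j) by rewrite divr_ge0 ?exprn_ge0//; lra.
  lra.
pose S := [set a k - 2 * C / 2 ^+ k | k in [set: nat]].
have ubS m : ubound S (a m + 2 * C / 2 ^+ m).
  move=> _ [k _ <-]; apply: (le_trans (lo k m)).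
  by rewrite addnC; exact: up.
exists (sup S) => k; rewrite ler_norml; apply/andP; split.
  have : sup S <= a k + 2 * C / 2 ^+ k.
    by apply: ge_sup => //; exists (a 0%N - 2 * C / 2 ^+ 0); exists 0%N.
  lra.
have : a k - 2 * C / 2 ^+ k <= sup S.
  by apply: ub_le_sup; [exists (a 0%N + 2 * C / 2 ^+ 0); exact: ubS | exists k].
lra.
Qed.

Lemma lipschitz_continuous n (x : R -> 'rV[R]_n) (M : R) : 0 <= M ->
  (forall s t, s <= t -> `|x t - x s| <= M * (t - s)) -> continuous x.
Proof.
move=> M0 h t.
have h' s : `|x t - x s| <= M * `|t - s|.
  have [st|ts] := leP s t; first by rewrite ger0_norm ?subr_ge0// h.
  rewrite distrC [`|t - s|]distrC (gtr0_norm (x := s - t)) ?subr_gt0//.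
  exact/h/ltW.
apply/cvgrPdist_lt => e e0.
have e1 : 0 < e / (M + 1) by rewrite divr_gt0//; lra.
exists (e / (M + 1)) => // s /= hs.
apply: (le_lt_trans (h' s)).
apply: (@le_lt_trans _ _ ((M + 1) * `|t - s|)); first by rewrite ler_wpM2r//; lra.
by rewrite mulrC -ltr_pdivlMr//; lra.
Qed.

End GeometricLimit.

(** * Uniqueness and Picard iteration for integral equations *)

Section ODE.
Context {R : realType} (N : nat).
Notation mu := (@lebesgue_measure R).
Implicit Types (x y g h : R -> 'rV[R]_N).

(** The integrand [g] is the right-hand side already evaluated along [x], so two curves can be
    compared through their integrands alone. *)
Definition integral_curve (T : R) (x0 : 'rV[R]_N) g x : Prop :=
  forall t, 0 <= t <= T -> forall i,
    mu.-integrable `[0, t] (EFin \o (fun s => g s ord0 i)) /\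
    x t ord0 i = x0 ord0 i + Rintegral mu `[0, t] (fun s => g s ord0 i).

(** In place of Gronwall's inequality, the weighted contraction is iterated from the crude bound
    [U]; each application halves the distance. *)
Lemma integral_curve_unique (T L U : R) (x0 : 'rV[R]_N) g h x y : 0 < L ->
  integral_curve T x0 g x -> integral_curve T x0 h y ->
  {ae mu, forall s, 0 <= s <= T -> `|g s - h s| <= L * `|x s - y s|} ->
  (forall t, 0 <= t <= T -> `|x t - y t| <= U) ->
  forall t, 0 <= t <= T -> x t = y t.
Proof.
move=> L0 xg yh gh xyU t tT.
have T0 : 0 <= T by case/andP: tT => /le_trans; apply.
have U0 : 0 <= U by apply: le_trans (xyU t tT).
have main k : forall s, 0 <= s <= T -> `|x s - y s| <= U / 2 ^+ k * expR (2 * L * s).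
  elim: k => [|k IH] s /[dup] sT /andP[s0 sT'].
    rewrite expr0 divr1 (le_trans (xyU s sT))// ler_peMr//.
    by rewrite -expR0 ler_expR !mulr_ge0// ltW.
  apply: rV_norm_le => [|i]; first by rewrite mulr_ge0 ?expR_ge0// divr_ge0// exprn_ge0.
  rewrite !mxE; have [Ig ->] := xg s sT i; have [Ih ->] := yh s sT i.
  rewrite opprD addrACA subrr add0r exprSr invfM mulrA.
  apply: Rintegral_weighted_contraction => //.
    by rewrite divr_ge0// exprn_ge0.
  apply: ae_sub gh => r hr /andP[r0 rs].
  have rT : 0 <= r <= T by rewrite r0 (le_trans rs).
  have := rV_norm_ge_entry (g r - h r) i; rewrite !mxE => /le_trans; apply.
  by apply: (le_trans (hr rT)); rewrite ler_pM2l// IH.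
apply/eqP; rewrite -subr_eq0 -normr_le0.
apply: (@le0_of_geometric _ _ (U * expR (2 * L * t))) => k.
by rewrite mulrAC; exact: main.
Qed.

(** The weight makes the Picard map a contraction on the whole half-line, so no gluing of short
    intervals is needed. The bound [M] makes all iterates Lipschitz with one constant; the limit
    inherits continuity, hence measurability of the integrand along it. *)
Lemma integral_curve_exists (F : R -> 'rV[R]_N -> 'rV[R]_N) (L M : R) (x0 : 'rV[R]_N) :
  0 < L -> 0 <= M ->
  (forall x, continuous x -> forall i t,
     measurable_fun (`[0, t]%classic : set (measurableTypeR R))
       (fun s => F s (x s) ord0 i)) ->
  {ae mu, forall s, 0 <= s -> forall u w, `|F s u - F s w| <= L * `|u - w|} ->
  {ae mu, forall s, 0 <= s -> forall u, `|F s u| <= M} ->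
  exists x, continuous x /\ forall T, integral_curve T x0 (fun s => F s (x s)) x.
Proof.
move=> L0 M0 Fm FL FM.
(* For negative [t] the interval is empty and the value is [x0], so the iterates are continuous on
   the whole line. *)
pose P x t := \row_i (x0 ord0 i + Rintegral mu `[0, t] (fun s => F s (x s) ord0 i)).
have Fint x : continuous x -> forall i t,
    mu.-integrable `[0, t] (EFin \o (fun s => F s (x s) ord0 i)).
  move=> xc i t; apply: (@ae_bounded_integrable _ _ _ _ M); first exact: Fm.
  apply: ae_sub FM => s h; rewrite /= in_itv /= => /andP[s0 _].
  exact: le_trans (rV_norm_ge_entry _ _) (h s0 _).
have Pneg x t : t < 0 -> P x t = x0.
  move=> t0; apply/rowP => i; rewrite mxE set_itv_ge ?bnd_simp -?ltNge//.
  by rewrite Rintegral_set0 addr0.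
have Pzero x : P x 0 = x0.
  by apply/rowP => i; rewrite mxE set_itv1 Rintegral_set1 addr0.
have PLip0 x : continuous x -> forall s t, 0 <= s -> s <= t -> `|P x t - P x s| <= M * (t - s).
  move=> xc s t s0 st.
  apply: rV_norm_le => [|i]; first by rewrite mulr_ge0// subr_ge0.
  rewrite !mxE opprD addrACA subrr add0r Rintegral_split//; last exact: Fint.
  apply: Rintegral_norm_le_ae => //; first exact/integrable_sub_itv/Fint.
  apply: ae_sub FM => r h /andP[sr rt].
  exact: le_trans (rV_norm_ge_entry _ _) (h (le_trans s0 sr) _).
have PLip x : continuous x -> forall s t, s <= t -> `|P x t - P x s| <= M * (t - s).
  move=> xc s t st; have [s0|s0] := leP 0 s; first exact: PLip0.
  rewrite (Pneg x s)//; have [t0|t0] := leP 0 t; last first.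
    by rewrite Pneg// subrr normr0 mulr_ge0// subr_ge0.
  rewrite -(Pzero x) (le_trans (PLip0 x xc 0 t _ t0))// subr0.
  by rewrite ler_wpM2l//; lra.
pose X k := iter k P (fun=> x0).
have Xc k : continuous (X k).
  elim: k => [|k IH]; first by move=> t; exact: cvg_cst.
  apply: (lipschitz_continuous M0) => s t; exact: PLip.
(* The first increment is at most [M * t = C * (2 * L * t)], hence at most
   [C * expR (2 * L * t)]. *)
pose C := M / (2 * L).
have C0 : 0 <= C by rewrite divr_ge0//; lra.
have contr x y (A : R) t : continuous x -> continuous y -> 0 <= A -> 0 <= t ->
    (forall s, 0 <= s -> `|x s - y s| <= A * expR (2 * L * s)) ->
    `|P x t - P y t| <= A / 2 * expR (2 * L * t).
  move=> xc yc A0 t0 xy.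
  apply: rV_norm_le => [|i]; first by rewrite mulr_ge0 ?expR_ge0// divr_ge0.
  rewrite !mxE opprD addrACA subrr add0r.
  apply: Rintegral_weighted_contraction => //; [exact: Fint | exact: Fint|].
  apply: ae_sub FL => r h /andP[r0 rt].
  have := rV_norm_ge_entry (F r (x r) - F r (y r)) i; rewrite !mxE => /le_trans; apply.
  by apply: (le_trans (h r0 _ _)); rewrite ler_pM2l// xy.
have Xstep k t : `|X k.+1 t - X k t| <= C / 2 ^+ k * expR (2 * L * t).
  have [t0|t0] := leP 0 t; last first.
    have -> : X k.+1 t = x0 by exact: Pneg.
    have -> : X k t = x0 by case: k => //= k; exact: Pneg.
    by rewrite subrr normr0 mulr_ge0 ?expR_ge0// divr_ge0// exprn_ge0.
  elim: k t t0 => [|k IH] t t0.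
    rewrite /X /= -{2}(Pzero (fun=> x0)).
    apply: (le_trans (PLip0 _ (Xc 0%N) 0 t (lexx _) t0)).
    rewrite subr0 expr0 divr1 /C.
    have -> : M * t = M / (2 * L) * (2 * L * t) by field; rewrite gt_eqF.
    rewrite ler_wpM2l//; have := expR_ge1Dx (2 * L * t); lra.
  rewrite exprSr invfM mulrA; apply: (contr (X k.+1) (X k)) => //; try exact: Xc.
  by rewrite divr_ge0// exprn_ge0.
have lim (ti : R * 'I_N) : exists l, forall k,
    `|X k ti.1 ord0 ti.2 - l| <= 2 * (C * expR (2 * L * ti.1)) / 2 ^+ k.
  apply: geometric_cauchy_limit; first by rewrite mulr_ge0 ?expR_ge0.
  move=> k; have := rV_norm_ge_entry (X k.+1 ti.1 - X k ti.1) ti.2.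
  by rewrite !mxE mulrAC => /le_trans; apply; exact: Xstep.
have [l lP] := choice lim.
pose x t := \row_i l (t, i).
have Xx k t : `|X k t - x t| <= 2 * C / 2 ^+ k * expR (2 * L * t).
  apply: rV_norm_le => [|i].
    by rewrite mulr_ge0 ?expR_ge0// divr_ge0 ?exprn_ge0// mulr_ge0.
  by rewrite !mxE; have := lP (t, i) k; rewrite mulrA mulrAC.
have xc : continuous x.
  apply: (lipschitz_continuous M0) => s t st; rewrite -subr_le0.
  apply: (@le0_of_geometric _ _ (2 * C * expR (2 * L * t) + 2 * C * expR (2 * L * s))) => k.
  have h1 := Xx k.+1 t; have h2 := Xx k.+1 s; have h3 := PLip _ (Xc k) s t st.
  have -> : x t - x s = - (X k.+1 t - x t) + (X k.+1 s - x s) + (X k.+1 t - X k.+1 s).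
    by rewrite opprB; apply/rowP => i; rewrite !mxE; ring.
  have := ler_normD (- (X k.+1 t - x t) + (X k.+1 s - x s)) (X k.+1 t - X k.+1 s).
  have := ler_normD (- (X k.+1 t - x t)) (X k.+1 s - x s); rewrite normrN.
  have hh (E : R) : 0 <= E -> 2 * C / 2 ^+ k.+1 * E <= 2 * C * E / 2 ^+ k.
    move=> E0; rewrite exprS invfM.
    have : 0 <= C * E * (2 ^+ k)^-1 by rewrite (mulr_ge0 (mulr_ge0 C0 E0))// invr_ge0 exprn_ge0.
    by set q := (2 ^+ k)^-1; lra.
  have := hh _ (expR_ge0 (2 * L * t)); have := hh _ (expR_ge0 (2 * L * s)).
  rewrite mulrDl; move: h1 h2 h3; rewrite -/(X k.+1).
  lra.
(* Both sides are geometrically close to [X k.+1 t = P (X k) t]: the left by the rate of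
   convergence, the right by contraction. *)
have xP t : 0 <= t -> x t = P x t.
  move=> t0; apply/eqP; rewrite -subr_eq0 -normr_le0.
  apply: (@le0_of_geometric _ _ (2 * C * expR (2 * L * t))) => k.
  have h1 := Xx k.+1 t.
  have h2 : `|P (X k) t - P x t| <= 2 * C / 2 ^+ k / 2 * expR (2 * L * t).
    by apply: contr => //; rewrite divr_ge0 ?exprn_ge0// mulr_ge0.
  have -> : x t - P x t = - (X k.+1 t - x t) + (P (X k) t - P x t).
    by rewrite /X /= opprB addrA subrK.
  apply: (le_trans (ler_normD _ _)); rewrite normrN.
  apply: (le_trans (lerD h1 h2)); rewrite -mulrDl exprS invfM.
  rewrite [leRHS]mulrAC ler_wpM2r ?expR_ge0//; lra.
exists x; split => // T t /andP[t0 tT] i; split; first exact: Fint.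
by rewrite [in LHS]xP// mxE.
Qed.

End ODE.

(** * Measurable compositions and compactness *)

Section MeasurableComposition.
Context {R : realType}.
Variables (E : set (measurableTypeR R)) (mE : measurable E).

(* Measurability along a countable dense family of balls; unlike a statement
   about all open sets, it passes directly to products and row vectors. *)
Definition ball_measurable (T : pseudoMetricType R) (u : R -> T) : Prop :=
  exists (I : countType) (Q : I -> T),
    (forall y e, 0 < e -> exists i, ball y e (Q i)) /\
    (forall i e, @measurable _ (measurableTypeR R) (E `&` [set s | ball (Q i) e (u s)])).

(** An open set is the union of the balls it contains whose centres lie in the dense family and
    whose radii are [1 / (m + 1)], a countable union. *)
Lemma ball_measurable_open (T : pseudoMetricType R) (u : R -> T) (O : set T) :
  ball_measurable u -> open O ->
  @measurable _ (measurableTypeR R) (E `&` [set s | O (u s)]).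
Proof.
move=> [I [Q [Qd Qm]]] oO.
pose good (im : I * nat) := ball (Q im.1) (im.2.+1%:R^-1 : R) `<=` O.
pose W (im : I * nat) : set (measurableTypeR R) :=
  if `[< good im >] then E `&` [set s | ball (Q im.1) (im.2.+1%:R^-1) (u s)] else set0.
rewrite (_ : _ `&` _ = \bigcup_im W im).
  apply: countable_bigcupT_measurable => // im; rewrite /W.
  by case: asboolP => _; [exact: Qm | exact: measurable0].
apply/seteqP; split => [s [Es Os]|s [im _]]; last first.
  by rewrite /W; case: asboolP => // g [Es bs]; split => //; exact: g.
have [e /= e0 eO] : nbhs_ball (u s) O by rewrite nbhs_ballE; exact: open_nbhs_nbhs.
pose m := Num.trunc (2 / e).
have me : 2 / e < m.+1%:R by exact: truncnS_gt.
have m0 : 0 < m.+1%:R^-1 :> R by rewrite invr_gt0.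
have mee : m.+1%:R^-1 + m.+1%:R^-1 <= e.
  rewrite -[_^-1]mul1r -mulrDl ler_pdivrMr//.
  by rewrite ltr_pdivrMr// mulrC in me; exact: ltW.
have [i bi] := Qd (u s) _ m0.
exists (i, m) => //; rewrite /W; case: asboolP => [_|ng]; first by split => //; exact: ball_sym.
exfalso; apply: ng => y /= by_; apply: eO.
exact: (le_ball mee (ball_triangle bi by_)).
Qed.

Lemma ball_measurable_real (u : R -> R) : measurable_fun E u -> ball_measurable (u : R -> R).
Proof.
move=> mu_; exists rat, ratr; split => [y e e0|q e].
  have [|q] := @rat_in_itvoo R (y - e) (y + e); first by lra.
  by rewrite in_itv /= => /andP[q1 q2]; exists q; rewrite /ball /= ltr_distlC q1 q2.
have -> : [set s | ball (ratr q : R) e (u s)] = u @^-1` `]ratr q - e, ratr q + e[.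
  by apply/seteqP; split => s /=; rewrite in_itv /= /ball /= ltr_distlC.
by apply: mu_ => //; exact: measurable_itv.
Qed.

Lemma ball_measurable_pair (T1 T2 : pseudoMetricType R) (u1 : R -> T1) (u2 : R -> T2) :
  ball_measurable u1 -> ball_measurable u2 -> ball_measurable (fun s => (u1 s, u2 s)).
Proof.
move=> [I1 [Q1 [d1 m1]]] [I2 [Q2 [d2 m2]]].
exists (I1 * I2)%type, (fun i => (Q1 i.1, Q2 i.2)); split => [[y1 y2] e e0|[i1 i2] e /=].
  by have [i1 b1] := d1 y1 e e0; have [i2 b2] := d2 y2 e e0; exists (i1, i2).
rewrite (_ : _ `&` _ = (E `&` [set s | ball (Q1 i1) e (u1 s)]) `&`
                       (E `&` [set s | ball (Q2 i2) e (u2 s)])).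
  exact: measurableI.
by apply/seteqP; split => s /=; [move=> [? []] | move=> [[? ?] []]].
Qed.

Lemma ball_measurable_row n (u : R -> 'rV[R]_n) :
  (forall i, measurable_fun E (fun s => u s ord0 i)) -> ball_measurable u.
Proof.
move=> mu_; exists ('rV[rat]_n : countType), (fun q => map_mx ratr q).
split => [y e e0|q e].
  have H (i : 'I_n) : exists q : rat, ratr q \in `]y ord0 i - e, y ord0 i + e[.
    by apply: rat_in_itvoo; lra.
  have [q qP] := choice H; exists (\row_i q i); split => // i j.
  rewrite !mxE [i]ord1; have := qP j; rewrite in_itv /= => /andP[q1 q2].
  by rewrite /ball /= ltr_distlC q1 q2.
(* For [n = 0] the entrywise conditions are vacuous, so balls of nonpositive radius are treated
   apart. *)
have [e0|e0] := ltP 0 e; last first.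
  rewrite (_ : _ `&` _ = set0); first exact: measurable0.
  by apply/seteqP; split => s //= [_ [/lt_le_trans /(_ e0)]]; rewrite ltxx.
rewrite (_ : _ `&` _ = E `\` \bigcup_i (E `&` (fun s => u s ord0 i) @^-1`
   (~` `]ratr (q ord0 i) - e, ratr (q ord0 i) + e[%classic))).
  apply: measurableD => //; apply: countable_bigcupT_measurable => // i.
  by apply: mu_ => //; apply: measurableC; exact: measurable_itv.
apply/seteqP; split => s /= [Es].
  move=> [_ h]; split => // -[i _ [_ /=]]; apply.
  by have := h ord0 i; rewrite !mxE /ball /= ltr_distlC in_itv.
move=> h; split => //; split => // i j; rewrite !mxE [i]ord1.
apply: contrapT => nb; apply: h; exists j => //; split => //=; rewrite in_itv /= => h.
by apply: nb; rewrite /ball /= ltr_distlC.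
Qed.

(** As [phi] is continuous only relative to [A], the preimage of a ray is the trace on [A] of an
    open set [W]; since [u] stays in [A], testing [u] against [W] is enough. In the application [A]
    constrains the input values. *)
Lemma measurable_within_continuous_comp (T : pseudoMetricType R) (A : set T)
  (phi : T -> R) (u : R -> T) :
  {within A, continuous phi} -> ball_measurable u -> (forall s, E s -> A (u s)) ->
  measurable_fun E (fun s => phi (u s)).
Proof.
move=> phic mu_ uA.
apply: (measurability _ (RGenOInfty.measurableE R)) => //= _ [_ [a ->] <-].
have oU : open ((phi @^-1` `]a, +oo[%classic) : set (subspace A)).
  by move/continuousP: phic; apply; exact: interval_open.
have [W oW WE] := (open_subspaceP A _).1 oU.
rewrite (_ : _ `&` _ = E `&` [set s | W (u s)]); first exact: ball_measurable_open.
apply/seteqP; split => s /= [Es h]; split => //.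
  have : (phi @^-1` `]a, +oo[%classic `&` A) (u s) by split => //; exact: uA.
  by rewrite -WE => -[].
have : (W `&` A) (u s) by split => //; exact: uA.
by rewrite WE => -[].
Qed.

End MeasurableComposition.

Section EuclideanNorm.
Context {R : realType}.

Lemma enorm_ge0 k (x : 'rV[R]_k) : 0 <= enorm x.
Proof. exact: sqrtr_ge0. Qed.

Lemma norm_le_enorm k (x : 'rV[R]_k) : `|x| <= enorm x.
Proof.
apply: rV_norm_le => [|i]; first exact: enorm_ge0.
rewrite -sqrtr_sqr ler_wsqrtr// (bigD1 i)//= lerDl.
by apply: sumr_ge0 => j _; exact: sqr_ge0.
Qed.

Lemma enorm_le_norm k (x : 'rV[R]_k) : enorm x <= k%:R * `|x|.
Proof.
have kx : 0 <= k%:R * `|x| by rewrite mulr_ge0.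
rewrite -(ger0_norm kx) -sqrtr_sqr ler_wsqrtr//.
have sum_sq (s : seq 'I_k) :
    \sum_(i <- s) x ord0 i ^+ 2 <= (\sum_(i <- s) `|x ord0 i|) ^+ 2.
  elim: s => [|i s IH]; first by rewrite !big_nil expr0n.
  rewrite !big_cons sqrrD real_normK ?num_real//.
  have : 0 <= \sum_(j <- s) `|x ord0 j| by exact: sumr_ge0.
  have := normr_ge0 (x ord0 i); move: IH; nra.
apply: (le_trans (sum_sq _)); rewrite ler_sqr ?nnegrE// ?sumr_ge0//.
rewrite (le_trans (ler_sum _ (fun i _ => rV_norm_ge_entry x i)))//.
by rewrite sumr_const card_ord mulr_natl.
Qed.

End EuclideanNorm.

(** * Uniform bounds and Lipschitz constants on balls *)

Section Compactness.
Context {R : realType}.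

Lemma pair_normE n (u : 'rV[R]_n * R) : `|u| = Num.max `|u.1| `|u.2|.
Proof. by []. Qed.

(** Reduces linear functionals of the state to finite sums of coordinates, both for bounding ['d V]
    and for moving it under an integral. *)
Lemma pair_sum_delta n (u : 'rV[R]_n * R) :
  u = \sum_(i < n) u.1 ord0 i *: ('e_i, 0 : R) + u.2 *: (0, 1 : R).
Proof.
case: u => x z /=.
have -> : \sum_(i < n) x ord0 i *: ('e_i, 0 : R) =
          (\sum_(i < n) x ord0 i *: 'e_i, 0) :> 'rV[R]_n * R.
  elim/big_rec2: _ => // i y1 y2 _ ->.
  by congr pair; rewrite /= ?scaler0 ?add0r.
rewrite -row_sum_delta; congr pair; rewrite /= ?scaler0 ?addr0 ?add0r//.
by rewrite /GRing.scale /= mulr1.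
Qed.

Lemma compact_norm_ball n (K : R) : compact [set x : 'rV[R]_n | `|x| <= K].
Proof.
apply: bounded_closed_compact.
  exists K; split; first exact: num_real.
  by move=> M KM x /= /le_trans; apply; exact: ltW.
apply: (@preimage_closed _ _ (fun x : 'rV[R]_n => `|x|) [set x | x <= K]).
  by move=> x _; exact: norm_continuous.
exact: closed_le.
Qed.

Lemma compact_closed_ball n (A : set 'rV[R]_n) (K : R) : closed A ->
  compact (A `&` [set x | `|x| <= K]).
Proof.
move=> cA; rewrite setIC; apply: compact_closedI => //; exact: compact_norm_ball.
Qed.

Lemma compact_real_ball (K : R) : compact [set z : R | `|z| <= K].
Proof.
have -> : [set z : R | `|z| <= K] = `[- K, K]%classic.
  by apply/seteqP; split => z /=; rewrite in_itv /= ler_norml.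
exact: segment_compact.
Qed.

Lemma compact_pair_ball n (K : R) : compact [set a : 'rV[R]_n * R | `|a| <= K].
Proof.
have -> : [set a : 'rV[R]_n * R | `|a| <= K] = [set x | `|x| <= K] `*` [set z | `|z| <= K].
  apply/seteqP; split => -[x z] /=; rewrite pair_normE /= ge_max.
    by case/andP.
  by case=> -> ->.
by apply: compact_setX; [exact: compact_norm_ball | exact: compact_real_ball].
Qed.

Lemma within_continuous_bounded (T : topologicalType) (W : normedModType R)
  (A : set T) (g : T -> W) : compact A -> {within A, continuous g} ->
  exists2 M, 0 <= M & forall x, A x -> `|g x| <= M.
Proof.
move=> cA gc; have [M [_ hM]] := compact_bounded (continuous_compact gc cA).
exists (`|M| + 1); first by rewrite addr_ge0.
by move=> x Ax; apply: hM; [rewrite ltr_pwDr// ler_norm | exists x].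
Qed.

(** Continuity of the differential is given one direction at a time; bounds in the finitely many
    basis directions add up to a bound uniform in [h]. *)
Lemma diff_pair_bound n (V : 'rV[R]_n * R -> R) (K : R) :
  (forall h : 'rV[R]_n * R, continuous (fun x : 'rV[R]_n * R => 'd V x h)) ->
  (forall x : 'rV[R]_n * R, differentiable V x) ->
  exists2 C, 0 <= C & forall w h : 'rV[R]_n * R, `|w| <= K -> `|'d V w h| <= C * `|h|.
Proof.
move=> dc dV.
have bd (h : 'rV[R]_n * R) : exists C, 0 <= C /\ forall w, `|w| <= K -> `|'d V w h| <= C.
  have [C C0 CP] := within_continuous_bounded (@compact_pair_ball n K)
    (continuous_subspaceT (dc h)).
  by exists C.
have [C CP] := choice bd.
exists (\sum_(i < n) C ('e_i, 0) + C (0, 1)).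
  rewrite addr_ge0 ?(CP _).1// sumr_ge0// => i _; exact: (CP _).1.
move=> w [x z] wK; set B := `|_ : 'rV[R]_n * R|.
have zB : `|z| <= B by rewrite /B pair_normE /= le_max lexx orbT.
have xB : `|x| <= B by rewrite /B pair_normE /= le_max lexx.
rewrite (pair_sum_delta (x, z)) linearD linear_sum /= linearZ /=.
apply: (le_trans (ler_normD _ _)); rewrite mulrDl; apply: lerD; last first.
  rewrite /GRing.scale /= normrM mulrC.
  by apply: ler_pM => //; exact: (CP _).2.
apply: (le_trans (ler_norm_sum _ _ _)); rewrite mulr_suml; apply: ler_sum => i _.
rewrite linearZ /= /GRing.scale /= normrM mulrC.
apply: ler_pM => //; first exact: (CP _).2.
exact: le_trans (rV_norm_ge_entry _ _) xB.
Qed.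

(** Mean value theorem along the segment from [a] to [b], which stays in the ball by convexity. *)
Lemma C1_lipschitz_on_ball n (V : 'rV[R]_n * R -> R) (K : R) :
  (forall h : 'rV[R]_n * R, continuous (fun x : 'rV[R]_n * R => 'd V x h)) ->
  (forall x : 'rV[R]_n * R, differentiable V x) ->
  exists2 C, 0 <= C & forall a b : 'rV[R]_n * R, `|a| <= K -> `|b| <= K ->
    `|V b - V a| <= C * `|b - a|.
Proof.
move=> dc dV; have [C C0 CP] := diff_pair_bound K dc dV.
exists C => // a b aK bK.
pose w (u : R) := u *: (b - a) + a.
pose phi u := V (w u).
have dphi (u : R) : is_derive u 1 phi ('d V (w u) (b - a)).
  have E : (fun h : R => h^-1 *: ((phi \o shift u) (h *: 1) - phi u)) =
           (fun h : R => h^-1 *: ((V \o shift (w u)) (h *: (b - a)) - V (w u))).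
    apply/funext => h; rewrite /phi /w /=; congr (_ *: (V _ - _)).
    by rewrite /GRing.scale /= mulr1 -/(GRing.scale _ _) scalerDl addrA.
  have dd : derivable V (w u) (b - a) by exact: diff_derivable.
  apply: DeriveDef; first by rewrite /derivable E.
  by rewrite /derive E -deriveE.
have [c c01] := MVT_segment ler01 (fun x _ => dphi x)
  (derivable_within_continuous (fun x _ => @ex_derive _ _ _ _ _ _ _ (dphi x))).
rewrite /phi /w scale0r add0r scale1r subrK subr0 mulr1 => ->.
apply: CP; rewrite /w.
have -> : c *: (b - a) + a = c *: b + (1 - c) *: a.
  by rewrite scalerBr scalerBl scale1r -addrA; congr (_ + _); rewrite addrC.
move: c01; rewrite in_itv /= => /andP[c0 c1].
apply: (le_trans (ler_normD _ _)); rewrite !normrZ ger0_norm// ger0_norm ?subr_ge0//.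
have c1' : 0 <= 1 - c by rewrite subr_ge0.
have := ler_wpM2l c0 bK; have := ler_wpM2l c1' aK; lra.
Qed.

Lemma locally_lipschitz_on_ball (T : Type) n (W : normedModType R)
  (P : T -> Prop) (g : T -> 'rV[R]_n * R -> W) (K M : R) : 0 <= M ->
  (forall i a, P i -> `|a| <= K -> `|g i a| <= M) ->
  (forall a0, `|a0| <= K -> exists2 r, 0 < r & exists L, forall i a b, P i ->
     `|a - a0| < r -> `|b - a0| < r -> `|g i a - g i b| <= L * `|a - b|) ->
  exists2 L, 0 < L & forall i a b, P i -> `|a| <= K -> `|b| <= K ->
     `|g i a - g i b| <= L * `|a - b|.
Proof.
(* Pairs of distant points are handled by the bound [M]. *)
move=> M0 gM gL.
pose Q (L : R) (a : 'rV[R]_n * R) :=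
  forall i b, P i -> `|b| <= K -> `|g i a - g i b| <= L * `|a - b|.
have /near_covering_withinP cov := (compact_near_coveringP _).1 (@compact_pair_ball n K).
have cov' : \forall L \near +oo, [set a : 'rV[R]_n * R | `|a| <= K] `<=` Q L.
  apply: cov => a0 a0K; have [r r0 [L0 hL]] := gL a0 a0K.
  (* If [b] is at distance at least [r] from [a0], then [a] and [b] are at least [r / 2] apart, and
     [4 * M / r * (r / 2)] is the trivial bound [2 * M]. *)
  pose L1 := Num.max L0 (4 * M / r).
  have r2 : 0 < r / 2 by rewrite divr_gt0.
  exists (ball a0 (r / 2), [set L | L1 <= L]) => /=.
    by split; [exact: nbhsx_ballx | apply: nbhs_pinfty_ge; rewrite num_real].
  move=> [a L] /= []; rewrite -ball_normE /= distrC => aa0 L1L aK i b Pi bK.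
  have L0L : L0 <= L by apply: le_trans L1L; rewrite le_max lexx.
  have L2L : 4 * M / r <= L by apply: le_trans L1L; rewrite le_max lexx orbT.
  have [ba0|ba0] := ltP `|b - a0| r.
    have ar : `|a - a0| < r by lra.
    by apply: (le_trans (hL i a b Pi ar ba0)); rewrite ler_wpM2r.
  have ab : r / 2 <= `|a - b|.
    have := ler_distD a b a0; rewrite [`|b - a|]distrC; lra.
  have h1 : `|g i a - g i b| <= 2 * M.
    apply: (le_trans (ler_normB _ _)); have := gM i a Pi aK; have := gM i b Pi bK; lra.
  apply: (le_trans h1).
  apply: (@le_trans _ _ (4 * M / r * `|a - b|)); last by rewrite ler_wpM2r.
  apply: (@le_trans _ _ (4 * M / r * (r / 2))).
    have -> : 4 * M / r * (r / 2) = 2 * M by field; rewrite gt_eqF.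
    exact: lexx.
  by rewrite ler_wpM2l// divr_ge0 ?mulr_ge0// ltW.
have [L [_ HL]] := cov'.
exists (Num.max 1 (L + 1)); first by rewrite lt_max ltr01.
move=> i a b Pi aK bK; apply: HL => //.
by rewrite lt_max ltrDl ltr01 orbT.
Qed.

End Compactness.

(** * Essential bounds and the supply rate *)

Section EssentialBounds.
Context {R : realType}.
Notation mu := (@lebesgue_measure R).
Implicit Types (g : R -> R) (T : R).

Let ubs T g := [set M : R | {ae mu, forall t, T <= t -> g t <= M}].

(** A half-line is not a null set. This bounds from below the set whose infimum is [ess_sup_from],
    so that the infimum is a genuine one. *)
Lemma ae_ubound_ge0 T g M : (forall t, 0 <= g t) ->
  {ae mu, forall t, T <= t -> g t <= M} -> 0 <= M.
Proof.
move=> g0 [N [mN N0 sN]]; rewrite leNgt; apply/negP => M0.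
have sub : `[T, +oo[%classic `<=` N.
  move=> t; rewrite /= in_itv /= andbT => Tt; apply: sN => /= /(_ Tt).
  by move=> /(le_trans (g0 t)) /le_lt_trans /(_ M0); rewrite ltxx.
have : (mu `[T, +oo[%classic <= mu N)%E by apply: le_measure; rewrite ?inE.
by rewrite N0 lebesgue_measure_itv /= ltry.
Qed.

(** The infimum is attained: enlarged by [1 / (k + 1)] it is an almost everywhere bound, and the
    countably many exceptional sets have a null union. *)
Lemma ess_sup_from_ae T g M : (forall t, 0 <= g t) ->
  {ae mu, forall t, T <= t -> g t <= M} ->
  {ae mu, forall t, T <= t -> g t <= ess_sup_from T g}.
Proof.
move=> g0 gM.
have hinf : has_inf (ubs T g).
  split; first by exists M.
  by exists 0 => K; exact: ae_ubound_ge0.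
have step k : {ae mu, forall t, T <= t -> g t <= ess_sup_from T g + k.+1%:R^-1}.
  have k0 : 0 < k.+1%:R^-1 :> R by rewrite invr_gt0.
  have [K KP Klt] := inf_adherent k0 hinf.
  apply: ae_sub KP => t h Tt; exact: le_trans (h Tt) (ltW Klt).
have neg : mu.-negligible (\bigcup_k ~` [set t : measurableTypeR R |
    T <= t -> g t <= ess_sup_from T g + k.+1%:R^-1]).
  exact: negligible_bigcup.
apply: negligibleS neg => t /not_implyP[Tt /negP]; rewrite -ltNge => gt.
pose k := Num.trunc (g t - ess_sup_from T g)^-1.
exists k => //=; apply/not_implyP; split => //; apply/negP; rewrite -ltNge -ltrBrDl.
rewrite invf_plt ?posrE ?subr_gt0//; exact: truncnS_gt.
Qed.

Lemma ess_sup_from_le T g M : (forall t, 0 <= g t) ->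
  {ae mu, forall t, T <= t -> g t <= M} -> ess_sup_from T g <= M.
Proof.
by move=> g0 gM; apply: ge_inf => //; exists 0 => K; exact: ae_ubound_ge0.
Qed.

Lemma ess_sup_from_ge0 T g M : (forall t, 0 <= g t) ->
  {ae mu, forall t, T <= t -> g t <= M} -> 0 <= ess_sup_from T g.
Proof.
by move=> g0 gM; apply: (ae_ubound_ge0 g0); exact: (ess_sup_from_ae g0 gM).
Qed.

Lemma ess_sup_from_mono T T' g M : T <= T' -> (forall t, 0 <= g t) ->
  {ae mu, forall t, T <= t -> g t <= M} -> ess_sup_from T' g <= ess_sup_from T g.
Proof.
move=> TT g0 gM; apply: ess_sup_from_le => //.
apply: ae_sub (ess_sup_from_ae g0 gM) => t h T't; apply: h; exact: le_trans T't.
Qed.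

Lemma ess_limsup_approx g M e : 0 < e -> (forall t, 0 <= g t) ->
  {ae mu, forall t, 0 <= t -> g t <= M} ->
  exists2 T, 0 <= T & forall T', T <= T' -> 
    ess_limsup g <= ess_sup_from T' g <= ess_limsup g + e.
Proof.
move=> e0 g0 gM.
have gMT T : 0 <= T -> {ae mu, forall t, T <= t -> g t <= M}.
  by move=> T0; apply: ae_sub gM => t h Tt; apply: h; exact: le_trans Tt.
have lb : lbound [set ess_sup_from T g | T in [set T : R | 0 <= T]] 0.
  by move=> _ [T T0 <-]; apply: ess_sup_from_ge0 (gMT _ T0).
have hinf : has_inf [set ess_sup_from T g | T in [set T : R | 0 <= T]].
  by split; [exists (ess_sup_from 0 g), 0 => //=|exists 0].
have [_ [T T0 <-] Tlt] := inf_adherent e0 hinf.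
exists T => // T' TT'; apply/andP; split.
  apply: ge_inf; first by exists 0.
  by exists T' => //=; exact: le_trans TT'.
by apply: (le_trans (ess_sup_from_mono TT' g0 (gMT _ T0))); exact: ltW.
Qed.

End EssentialBounds.

Lemma limsupE_le {R : realType} (g : R -> R) (r : R) :
  (forall e, 0 < e -> exists2 T, 0 <= T & forall t, T <= t -> g t <= r + e) ->
  (limsupE g <= r%:E)%E.
Proof.
move=> h; apply/lee_addgt0Pr => e e0; have [T T0 hT] := h e e0.
apply: (@le_trans _ _ (ereal_sup [set (g t)%:E | t in [set t : R | T <= t]])).
  by apply: ereal_inf_lbound; exists T.
by apply: ge_ereal_sup => _ [t Tt <-]; rewrite -EFinD lee_fin; exact: hT.
Qed.

Lemma within_continuous_cvg (S T U : topologicalType) (F : set_system S) {FF : Filter F}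
  (A : set T) (g : T -> U) (u : S -> T) (l : T) :
  {within A, continuous g} -> A l -> (forall s, A (u s)) ->
  u s @[s --> F] --> l -> g (u s) @[s --> F] --> g l.
Proof.
move=> gc Al uA ul W /(gc l) h.
have : within A (nbhs l) (g @^-1` W) by rewrite (nbhs_subspace_in Al) //.
by move=> /ul; rewrite /nbhs /= => h1; apply: filterS h1 => s; apply; exact: uA.
Qed.

(** * Monotonicity and continuity of the supply rate *)

Section SupplyRate.
Context {R : realType}.
Variables (a b : R) (lam kap : R -> R).
Hypotheses (ha : 0 < a) (hlam : classK lam) (hkap : classK kap).

Lemma pos_ge0 (x : R) : 0 <= pos x.
Proof. by rewrite /pos le_max lexx orbT. Qed.

Lemma pos_mono (x y : R) : x <= y -> pos x <= pos y.
Proof. by move=> xy; rewrite /pos ge_max !le_max xy lexx orbT. Qed.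

Lemma chi_ge0 (s1 s2 s3 : R) : 0 <= s3 -> 0 <= chi a b lam kap s1 s2 s3.
Proof.
move=> s30; rewrite /chi divr_ge0//; last by rewrite addr_ge0// classK_ge0.
by rewrite mulr_ge0 ?(ltW ha)// addr_ge0 ?sqr_ge0.
Qed.

Lemma chi_mono (s1 s2 s3 t1 t2 t3 : R) : 0 <= s1 -> s1 <= t1 -> s2 <= t2 ->
  0 <= t3 -> t3 <= s3 -> chi a b lam kap s1 s2 s3 <= chi a b lam kap t1 t2 t3.
Proof.
move=> s10 st1 st2 t30 ts3.
have k3 : kap t3 <= kap s3 by exact: classK_mono.
have l3 : lam t3 <= lam s3 by exact: classK_mono.
have kt : 0 <= kap t3 by exact: classK_ge0.
have p0 := pos_ge0 (s2 - b - lam s3).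
have pp : pos (s2 - b - lam s3) <= pos (t2 - b - lam t3) by apply: pos_mono; lra.
rewrite /chi; apply: ler_pM.
- by rewrite mulr_ge0 ?(ltW ha)// addr_ge0 ?sqr_ge0.
- by rewrite invr_ge0; lra.
- rewrite ler_pM2l//; apply: lerD; rewrite ler_sqr// ?nnegrE ?pos_ge0//.
  exact: le_trans st1.
- by rewrite lef_pV2 ?posrE; lra.
Qed.

Lemma pos_continuous : continuous (pos : R -> R).
Proof.
move=> x; exact: (@continuous_max _ _ _ _ x (@cvg_id _ _) (@cst_continuous R R^o 0 x)).
Qed.

Lemma chi_cvg (T : topologicalType) (F : set_system T) {FF : Filter F}
  (u1 u2 u3 : T -> R) (l1 l2 l3 : R) : 0 <= l3 -> (forall t, 0 <= u3 t) ->
  u1 t @[t --> F] --> l1 -> u2 t @[t --> F] --> l2 -> u3 t @[t --> F] --> l3 ->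
  chi a b lam kap (u1 t) (u2 t) (u3 t) @[t --> F] --> chi a b lam kap l1 l2 l3.
Proof.
move=> l30 u30 c1 c2 c3.
have Kc (al : R -> R) : classK al -> al (u3 t) @[t --> F] --> al l3.
  by move=> [alc _]; exact: (within_continuous_cvg alc).
rewrite /chi; apply: cvgM.
  apply: cvgM; first exact: cvg_cst.
  apply: cvgD.
    by rewrite expr2; under eq_fun do rewrite expr2; exact: cvgM.
  rewrite expr2; under eq_fun do rewrite expr2.
  have cp : pos (u2 t - b - lam (u3 t)) @[t --> F] --> pos (l2 - b - lam l3).
    apply: (@cvg_comp _ _ _ (fun t => u2 t - b - lam (u3 t)) pos); last exact: pos_continuous.
    by apply: cvgB; [apply: cvgB => //; exact: cvg_cst | exact: Kc].
  exact: cvgM.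
apply: cvgV; first by rewrite gt_eqF// ltr_pwDl// classK_ge0.
by apply: cvgD; [exact: cvg_cst | exact: Kc].
Qed.

End SupplyRate.

Section FiniteSums.
Context {R : realType}.
Notation mu := (@lebesgue_measure R).

Lemma Rintegral_lin_comb (I : Type) (r : seq I) (c : I -> R) (g : I -> R -> R) (s t : R) :
  (forall i, mu.-integrable `[s, t] (EFin \o g i)) ->
  mu.-integrable `[s, t] (EFin \o (fun x => \sum_(i <- r) c i * g i x)) /\
  Rintegral mu `[s, t] (fun x => \sum_(i <- r) c i * g i x) =
  \sum_(i <- r) c i * Rintegral mu `[s, t] (g i).
Proof.
move=> Ig; elim: r => [|i r [I1 I2]].
  have -> : (fun x => \sum_(i <- [::]) c i * g i x) = (fun=> 0).
    by apply/funext => x; rewrite big_nil.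
  split; first exact: integrable_cst_itv.
  by rewrite big_nil /Rintegral integral0.
have -> : (fun x => \sum_(j <- i :: r) c j * g j x) =
          (fun x => c i * g i x + \sum_(j <- r) c j * g j x).
  by apply/funext => x; rewrite big_cons.
have Ii : mu.-integrable `[s, t] (EFin \o (fun x => c i * g i x)).
  exact: (integrableZl _ (c i) (Ig i)).
split; first exact: (integrableD _ Ii I1).
by rewrite RintegralD// I2 big_cons RintegralZl.
Qed.

End FiniteSums.

(** * The state as a single row vector, and its truncation to a box *)

Section StateEncoding.
Context {R : realType} {n : nat}.

Definition row_split (y : 'rV[R]_(n + 1)) : 'rV[R]_n * R := (lsubmx y, y ord0 (rshift n ord0)).
Definition row_join (u : 'rV[R]_n * R) : 'rV[R]_(n + 1) := row_mx u.1 (const_mx u.2).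

Lemma row_joinEl u (i : 'I_n) : row_join u ord0 (lshift 1 i) = u.1 ord0 i.
Proof. by rewrite /row_join row_mxEl. Qed.

Lemma row_joinEr u i : row_join u ord0 (rshift n i) = u.2.
Proof. by rewrite /row_join row_mxEr mxE. Qed.

Lemma row_joinK u : row_split (row_join u) = u.
Proof. by case: u => x w; rewrite /row_split /row_join row_mxKl row_mxEr mxE. Qed.

Lemma row_join_norm_le u : `|row_join u| <= `|u|.
Proof.
apply: rV_norm_le => // i; rewrite pair_normE le_max.
case: (split_ordP i) => j ->; first by rewrite row_joinEl rV_norm_ge_entry.
by rewrite row_joinEr lexx orbT.
Qed.

Lemma row_joinB u w : row_join u - row_join w = row_join (u - w).
Proof.
apply/rowP => i; rewrite [LHS]mxE [X in _ + X]mxE; case: (split_ordP i) => j ->.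
  by rewrite !row_joinEl !mxE.
by rewrite !row_joinEr.
Qed.

Lemma row_split_norm_le y : `|row_split y| <= `|y|.
Proof.
rewrite pair_normE ge_max /= rV_norm_ge_entry andbT.
by apply: rV_norm_le => // i; rewrite mxE rV_norm_ge_entry.
Qed.

Lemma row_splitB y y' : row_split y - row_split y' = row_split (y - y').
Proof. by congr pair; [apply/rowP => i; rewrite !mxE | rewrite /= !mxE]. Qed.

Definition clamp (K w : R) : R := Num.max (- K) (Num.min K w).

Lemma clamp_le K w : 0 <= K -> `|clamp K w| <= K.
Proof.
move=> K0; rewrite /clamp ler_norml le_max lexx /= ge_max ge_min lexx /= andbT; lra.
Qed.

Lemma clamp_id K w : `|w| <= K -> clamp K w = w.
Proof. by rewrite /clamp ler_norml => /andP[h1 h2]; rewrite min_r// max_r. Qed.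

Lemma maxr_lip (c x y : R) : `|Num.max c x - Num.max c y| <= `|x - y|.
Proof.
have [cx|xc] := leP c x; have [cy|yc] := leP c y => //.
- by rewrite !ger0_norm; lra.
- by rewrite !ler0_norm; lra.
- by rewrite subrr normr0.
Qed.

Lemma minr_lip (c x y : R) : `|Num.min c x - Num.min c y| <= `|x - y|.
Proof.
have [cx|xc] := leP c x; have [cy|yc] := leP c y => //.
- by rewrite subrr normr0.
- by rewrite !ger0_norm; lra.
- by rewrite !ler0_norm; lra.
Qed.

Lemma clamp_lip K w w' : `|clamp K w - clamp K w'| <= `|w - w'|.
Proof. exact: le_trans (maxr_lip _ _ _) (minr_lip _ _ _). Qed.

(** Truncation is entrywise because this is nonexpansive for the maximum norm, so it preserves
    Lipschitz constants. *)
Definition clamp_pair (K : R) (u : 'rV[R]_n * R) : 'rV[R]_n * R :=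
  (\row_i clamp K (u.1 ord0 i), clamp K u.2).

Lemma clamp_pair_le K u : 0 <= K -> `|clamp_pair K u| <= K.
Proof.
move=> K0; rewrite pair_normE ge_max clamp_le// andbT.
by apply: rV_norm_le => // i; rewrite mxE clamp_le.
Qed.

Lemma clamp_pair_id K u : `|u| <= K -> clamp_pair K u = u.
Proof.
case: u => x w; rewrite pair_normE ge_max /= => /andP[xK wK].
rewrite /clamp_pair /= clamp_id//; congr pair; apply/rowP => i.
by rewrite mxE clamp_id// (le_trans (rV_norm_ge_entry _ _)).
Qed.

Lemma clamp_pair_lip K u w : `|clamp_pair K u - clamp_pair K w| <= `|u - w|.
Proof.
rewrite !pair_normE ge_max !le_max /= clamp_lip orbT andbT; apply/orP; left.
apply: rV_norm_le => // i; rewrite !mxE; apply: (le_trans (clamp_lip _ _ _)).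
by have := rV_norm_ge_entry (u.1 - w.1) i; rewrite !mxE.
Qed.

Lemma clamp_split_continuous K (y : R -> 'rV[R]_(n + 1)) : continuous y ->
  continuous (fun s => clamp_pair K (row_split (y s))).
Proof.
move=> yc s; apply/cvgrPdist_lt => e e0.
have /cvgrPdist_lt /(_ e e0) := yc s; apply: filterS => t.
apply: le_lt_trans; apply: (le_trans (clamp_pair_lip _ _ _)).
by rewrite row_splitB; exact: row_split_norm_le.
Qed.

End StateEncoding.

(** * The adaptive system *)

Section System.
Context {R : realType} {n p l : nat}.
Variables (Th : set 'rV[R]_p) (D : set 'rV[R]_l) (Gam eps : R)
  (f : 'rV[R]_n -> R -> 'rV[R]_p -> 'rV[R]_l -> 'rV[R]_n)
  (V : 'rV[R]_n * R -> R).
Hypotheses (hTh : closed Th) (hD : closed D) (hGam : 0 < Gam)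
  (hfc : {within [set x : 'rV[R]_n * R * 'rV[R]_p * 'rV[R]_l | Th x.1.2 /\ D x.2],
           continuous (fun x : 'rV[R]_n * R * 'rV[R]_p * 'rV[R]_l =>
                         f x.1.1.1 x.1.1.2 x.1.2 x.2)})
  (hfL : forall (xi0 : 'rV[R]_n) (z0 K : R), exists r : R, exists L : R, 0 < r /\
           forall (xi xi' : 'rV[R]_n) (z z' : R) (th : 'rV[R]_p) (dd : 'rV[R]_l),
             enorm (xi - xi0) < r -> `|z - z0| < r ->
             enorm (xi' - xi0) < r -> `|z' - z0| < r ->
             Th th -> D dd -> enorm th <= K -> enorm dd <= K ->
             enorm (f xi z th dd - f xi' z' th dd) <= L * (enorm (xi - xi') + `|z - z'|))
  (hVd : forall x : 'rV[R]_n * R, differentiable V x)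
  (hVc : forall h : 'rV[R]_n * R, continuous (fun x : 'rV[R]_n * R => 'd V x h)).
Notation mu := (@lebesgue_measure R).

Definition vfield (a : 'rV[R]_n * R) (th : 'rV[R]_p) (dd : 'rV[R]_l) : 'rV[R]_n * R :=
  (f a.1 a.2 th dd, zdot V Gam eps a.1 a.2).

Let admissible (K : R) (i : 'rV[R]_p * 'rV[R]_l) :=
  [/\ Th i.1, D i.2, enorm i.1 <= K & enorm i.2 <= K].

Lemma V_continuous : continuous V.
Proof. by move=> x; exact: differentiable_continuous. Qed.

(** Closedness of [Th] and [D] makes the admissible input values range over compact sets, on whose
    product with a ball [f] is continuous. *)
Lemma f_bounded (K : R) : exists2 M, 0 <= M & forall i (a : 'rV[R]_n * R),
  admissible K i -> `|a| <= K -> `|f a.1 a.2 i.1 i.2| <= M.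
Proof.
pose A := [set a : 'rV[R]_n * R | `|a| <= K] `*` (Th `&` [set x | `|x| <= K]) `*`
          (D `&` [set x | `|x| <= K]).
have cA : compact A.
  apply: compact_setX; last exact: compact_closed_ball.
  by apply: compact_setX; [exact: compact_pair_ball | exact: compact_closed_ball].
have gc : {within A, continuous (fun x : 'rV[R]_n * R * 'rV[R]_p * 'rV[R]_l =>
                         f x.1.1.1 x.1.1.2 x.1.2 x.2)}.
  by apply: continuous_subspaceW hfc => -[[a th] dd] /= [[_ []]] + _ [].
have [M M0 MP] := within_continuous_bounded cA gc.
exists M => // -[th dd] [xi z] [/= h1 h2 h3 h4] aK.
apply: (MP (xi, z, th, dd)); split; [split|] => //=; split => //=.
  exact: le_trans (norm_le_enorm _) _.
exact: le_trans (norm_le_enorm _) _.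
Qed.

Lemma f_lipschitz (K : R) : exists2 L, 0 < L & forall i (a b : 'rV[R]_n * R),
  admissible K i -> `|a| <= K -> `|b| <= K ->
  `|f a.1 a.2 i.1 i.2 - f b.1 b.2 i.1 i.2| <= L * `|a - b|.
Proof.
have [M M0 MP] := f_bounded K.
apply: (@locally_lipschitz_on_ball _ _ _ _ (admissible K)
  (fun i a => f a.1 a.2 i.1 i.2) K M M0 MP).
move=> [xi0 z0] _; have [r [L [r0 hL]]] := hfL xi0 z0 K.
have n1 : 0 < n%:R + 1 :> R by rewrite ltr_wpDl.
(* Passage from the maximum norm to the Euclidean one costs at most a factor [n]; the added 1 covers
   [n = 0] and the scalar component. *)
exists (r / (n%:R + 1)); first by rewrite divr_gt0.
exists (`|L| * (n%:R + 1)) => -[th dd] [xi z] [xi' z'] [/= h1 h2 h3 h4].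
have small (x : 'rV[R]_n) : `|x| < r / (n%:R + 1) -> enorm x < r.
  move=> hx; apply: (le_lt_trans (enorm_le_norm x)).
  apply: (@le_lt_trans _ _ ((n%:R + 1) * `|x|)); first by rewrite ler_wpM2r// lerDl.
  by rewrite mulrC -ltr_pdivlMr.
have small' (x : R) : `|x| < r / (n%:R + 1) -> `|x| < r.
  move=> hx; apply: (lt_le_trans hx); rewrite ler_pdivrMr// ler_peMr ?(ltW r0)//.
  by rewrite lerDr.
rewrite !pair_normE /= !gt_max => /andP[a1 a2] /andP[b1 b2].
apply: (le_trans (norm_le_enorm _)).
apply: (le_trans (hL _ _ _ _ _ _ (small _ a1) (small' _ a2) (small _ b1) (small' _ b2)
  h1 h2 h3 h4)).
rewrite -mulrA.
apply: (@le_trans _ _ (`|L| * (enorm (xi - xi') + `|z - z'|))).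
  by rewrite ler_wpM2r ?ler_norm// addr_ge0// enorm_ge0.
rewrite ler_wpM2l// mulrDl mul1r; apply: lerD.
  by apply: (le_trans (enorm_le_norm _)); rewrite ler_wpM2l// le_max lexx.
by rewrite le_max lexx orbT.
Qed.

Lemma V_bounded (K : R) : exists2 M, 0 <= M & forall a, `|a| <= K -> `|V a| <= M.
Proof.
exact: (within_continuous_bounded (@compact_pair_ball R n K)
  (continuous_subspaceT V_continuous)).
Qed.

Lemma pos_lip (x y : R) : `|pos x - pos y| <= `|x - y|.
Proof. by rewrite /pos ![Num.max _ 0]maxC; exact: maxr_lip. Qed.

Lemma expR_lip (K x y : R) : x <= K -> y <= K -> `|expR x - expR y| <= expR K * `|x - y|.
Proof.
move=> xK yK.
wlog yx : x y xK yK / y <= x.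
  move=> h; have [yx|/ltW yx] := leP y x; first exact: h.
  by rewrite distrC [`|x - y|]distrC; exact: h.
rewrite !ger0_norm ?subr_ge0 ?ler_expR//.
apply: (@le_trans _ _ (expR x * (x - y))); last by rewrite ler_wpM2r ?subr_ge0// ler_expR.
have := expR_ge1Dx (y - x); rewrite expRD expRN => h.
have := ler_wpM2l (expR_ge0 x) h.
rewrite [in X in _ <= X]mulrC divfK ?gt_eqF ?expR_gt0//; lra.
Qed.

Lemma zdot_continuous : continuous (fun a : 'rV[R]_n * R => zdot V Gam eps a.1 a.2).
Proof.
move=> a; rewrite /zdot; apply: cvgM.
  apply: cvgM; first exact: cvg_cst.
  apply: (@continuous_comp _ _ _ (fun a : 'rV[R]_n * R => - a.2) expR);
    last exact: continuous_expR.
  by apply: cvgN; exact: cvg_snd.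
apply: (@continuous_comp _ _ _ (fun a : 'rV[R]_n * R => V (a.1, a.2) - eps) pos);
  last exact: pos_continuous.
apply: cvgB; last exact: cvg_cst.
have -> : (fun a : 'rV[R]_n * R => V (a.1, a.2)) = V by apply/funext => -[].
exact: V_continuous.
Qed.

Lemma zdot_bounded (K : R) : exists2 M, 0 <= M & forall a : 'rV[R]_n * R,
  `|a| <= K -> `|zdot V Gam eps a.1 a.2| <= M.
Proof.
exact: (within_continuous_bounded (@compact_pair_ball R n K)
  (continuous_subspaceT zdot_continuous)).
Qed.

Lemma zdot_lipschitz (K : R) : exists2 L, 0 < L & forall a b : 'rV[R]_n * R,
  `|a| <= K -> `|b| <= K ->
  `|zdot V Gam eps a.1 a.2 - zdot V Gam eps b.1 b.2| <= L * `|a - b|.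
Proof.
have [M M0 MP] := V_bounded K.
have [C C0 CP] := C1_lipschitz_on_ball K hVc hVd.
pose P := M + `|eps|.
have P0 : 0 <= P by rewrite addr_ge0.
have E0 := expR_gt0 K.
(* Product estimate: [expR K] bounds [expR (- z)] and its Lipschitz constant, [P] bounds the
   positive part and [C] its Lipschitz constant; the final 1 ensures positivity. *)
exists (Gam * expR K * (C + P) + 1).
  by rewrite ltr_wpDl// !mulr_ge0 ?addr_ge0// ltW.
move=> [x z] [x' z'] aK bK /=.
have zK : - z <= K.
  by move: aK; rewrite pair_normE /= ge_max => /andP[_]; rewrite ler_norml => /andP[]; lra.
have z'K : - z' <= K.
  by move: bK; rewrite pair_normE /= ge_max => /andP[_]; rewrite ler_norml => /andP[]; lra.
have hb : `|pos (V (x', z') - eps)| <= P.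
  rewrite ger0_norm ?pos_ge0// /pos ge_max P0 andbT.
  apply: (le_trans (ler_norm _)); apply: (le_trans (ler_normB _ _)).
  by rewrite lerD2r; exact: MP.
set d := `|(x, z) - (x', z')|.
have zd : `|z - z'| <= d by rewrite /d pair_normE /= le_max lexx orbT.
have h1 : `|pos (V (x, z) - eps) - pos (V (x', z') - eps)| <= C * d.
  apply: (le_trans (pos_lip _ _)); rewrite opprB addrA subrK; exact: CP.
have h2 : `|expR (- z) - expR (- z')| <= expR K * d.
  apply: (le_trans (expR_lip zK z'K)); rewrite ler_wpM2l ?(ltW E0)//.
  by rewrite opprK addrC distrC.
rewrite /zdot.
set p1 := pos (V (x, z) - eps) in h1 *; set p2 := pos (V (x', z') - eps) in h1 hb *.
have -> : Gam * expR (- z) * p1 - Gam * expR (- z') * p2 =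
  Gam * (expR (- z) * (p1 - p2) + (expR (- z) - expR (- z')) * p2) by ring.
have d0 : 0 <= d by exact: normr_ge0.
apply: (@le_trans _ _ (Gam * (expR K * (C * d) + expR K * d * P))); last first.
  rewrite (_ : (_ + 1) * d = Gam * (expR K * (C * d) + expR K * d * P) + d); last by ring.
  by rewrite lerDl.
rewrite normrM gtr0_norm// ler_pM2l//.
apply: (le_trans (ler_normD _ _)); apply: lerD; rewrite normrM; last exact: ler_pM.
by apply: ler_pM => //; rewrite ger0_norm ?expR_ge0// ler_expR.
Qed.

Lemma vfield_bounded (K : R) : exists2 M, 0 <= M & forall i a,
  admissible K i -> `|a| <= K -> `|vfield a i.1 i.2| <= M.
Proof.
have [M1 M10 H1] := f_bounded K; have [M2 M20 H2] := zdot_bounded K.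
exists (Num.max M1 M2); first by rewrite le_max M10.
move=> i a Hi aK; rewrite pair_normE /= ge_max !le_max; apply/andP; split.
  by rewrite H1.
by rewrite H2 ?orbT.
Qed.

Lemma vfield_lipschitz (K : R) : exists2 L, 0 < L & forall i a b,
  admissible K i -> `|a| <= K -> `|b| <= K ->
  `|vfield a i.1 i.2 - vfield b i.1 i.2| <= L * `|a - b|.
Proof.
have [M1 M10 H1] := f_lipschitz K; have [M2 M20 H2] := zdot_lipschitz K.
exists (Num.max M1 M2); first by rewrite lt_max M10.
move=> i a b Hi aK bK; rewrite pair_normE /= ge_max; apply/andP; split.
  by apply: (le_trans (H1 _ _ _ Hi aK bK)); rewrite ler_wpM2r// le_max lexx.
by apply: (le_trans (H2 _ _ aK bK)); rewrite ler_wpM2r// le_max lexx orbT.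
Qed.

Lemma diff_approx (a : 'rV[R]_n * R) (e : R) : 0 < e -> exists2 r, 0 < r &
  forall b, `|b - a| < r -> `|V b - V a - 'd V a (b - a)| <= e * `|b - a|.
Proof.
move=> e0; have := diff_locally (hVd a); move/eqaddoP => /(_ e e0) /nbhs_normP[r /= r0 hr].
exists r => // b bar; have := hr (b - a); rewrite /= sub0r normrN => /(_ bar).
by rewrite -[X in `|X|]/(V (b - a + a) - (V a + 'd V a (b - a))) subrK opprD addrA.
Qed.

Lemma lte_trans_fin (s t : R) (T : \bar R) : s <= t -> (t%:E < T)%E -> (s%:E < T)%E.
Proof. by move=> st; apply: le_lt_trans; rewrite lee_fin. Qed.

(** * Regularity of an arbitrary solution *)

Section Solutions.
Variables (theta : R -> 'rV[R]_p) (d : R -> 'rV[R]_l).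
Hypotheses (hd : Linf D d) (hth : Linf Th theta).

Lemma Linf_ae k (A : set 'rV[R]_k) (u : R -> 'rV[R]_k) (T : R) : Linf A u -> 0 <= T ->
  {ae mu, forall t, T <= t -> enorm (u t) <= ess_sup_from T (fun t => enorm (u t))}.
Proof.
move=> [_ [_ [M uM]]] T0.
apply: (@ess_sup_from_ae R T (fun t => enorm (u t)) M).
  by move=> t; exact: enorm_ge0.
by apply: ae_sub uM => t h Tt; apply: h; exact: le_trans Tt.
Qed.

Lemma linf_norm_ge0 k (A : set 'rV[R]_k) (u : R -> 'rV[R]_k) : Linf A u -> 0 <= linf_norm u.
Proof.
move=> uA; apply: (ae_ubound_ge0 (fun t => enorm_ge0 (u t))).
exact: (Linf_ae uA (lexx 0)).
Qed.

Lemma ae_admissible (K : R) : linf_norm d <= K -> linf_norm theta <= K ->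
  {ae mu, forall s, 0 <= s -> admissible K (theta s, d s)}.
Proof.
move=> dK tK.
apply: ae_sub (ae_and (Linf_ae hd (lexx 0)) (Linf_ae hth (lexx 0))).
move=> s [h1 h2] s0; split => /=.
- by case: hth => h _; exact: h.
- by case: hd => h _; exact: h.
- exact: le_trans (h2 s0) tK.
- exact: le_trans (h1 s0) dK.
Qed.

Section OneSolution.
Variables (xi0 : 'rV[R]_n) (z0 : R) (Tm : \bar R) (xi : R -> 'rV[R]_n) (z : R -> R).
Hypothesis sol : is_solution f V Gam eps theta d xi0 z0 Tm xi z.

Let x t := (xi t, z t).

Lemma sol_xi_increment s t i : 0 <= s -> s <= t -> (t%:E < Tm)%E ->
  mu.-integrable `[s, t] (EFin \o fun r => f (xi r) (z r) (theta r) (d r) ord0 i) /\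
  xi t ord0 i - xi s ord0 i =
    Rintegral mu `[s, t] (fun r => f (xi r) (z r) (theta r) (d r) ord0 i).
Proof.
move=> s0 st tT; have t0 := le_trans s0 st.
have [ht _] := sol.2 t t0 tT; have [It ->] := ht i.
have [hs _] := sol.2 s s0 (lte_trans_fin st tT); have [_ ->] := hs i.
split; first exact: (integrable_sub_itv s0 It).
by rewrite opprD addrACA subrr add0r Rintegral_split.
Qed.

Lemma sol_z_increment s t : 0 <= s -> s <= t -> (t%:E < Tm)%E ->
  mu.-integrable `[s, t] (EFin \o fun r => zdot V Gam eps (xi r) (z r)) /\
  z t - z s = Rintegral mu `[s, t] (fun r => zdot V Gam eps (xi r) (z r)).
Proof.
move=> s0 st tT; have t0 := le_trans s0 st.
have [_ [It ->]] := sol.2 t t0 tT.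
have [_ [_ ->]] := sol.2 s s0 (lte_trans_fin st tT).
split; first exact: (integrable_sub_itv s0 It).
by rewrite opprD addrACA subrr add0r Rintegral_split.
Qed.

Lemma sol_initial : xi 0 = xi0 /\ z 0 = z0.
Proof.
have [h [_ hz]] := sol.2 0 (lexx 0) sol.1; split.
  by apply/rowP => i; have [_ ->] := h i; rewrite set_itv1 Rintegral_set1 addr0.
by rewrite hz set_itv1 Rintegral_set1 addr0.
Qed.

(** Every coordinate is a constant plus a primitive of an integrable function, hence continuous and
    bounded on a compact interval. *)
Lemma sol_bounded T : 0 <= T -> (T%:E < Tm)%E ->
  exists2 K, 0 <= K & forall t, 0 <= t <= T -> `|x t| <= K.
Proof.
move=> T0 TTm; have [h [hzI hz]] := sol.2 T T0 TTm.
have bd (g : R -> R) : mu.-integrable `[0, T] (EFin \o g) ->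
    exists2 M, 0 <= M & forall t, 0 <= t <= T -> `|Rintegral mu `[0, t] g| <= M.
  move=> Ig; have gc := parameterized_integral_continuous T0 Ig.
  have [M M0 MP] := within_continuous_bounded (@segment_compact R 0 T) gc.
  by exists M => // t t0T; apply: MP; rewrite /= in_itv.
have bi (i : 'I_n) : exists M, 0 <= M /\ forall t, 0 <= t <= T -> `|xi t ord0 i| <= M.
  have [M M0 MP] := bd _ (h i).1.
  exists (`|xi0 ord0 i| + M); split; first by rewrite addr_ge0.
  move=> t /[dup] t0T /andP[t0 tT].
  have [ht _] := sol.2 t t0 (lte_trans_fin tT TTm).
  by have [_ ->] := ht i; apply: (le_trans (ler_normD _ _)); rewrite lerD2l MP.
have [Mi MiP] := choice bi.
have [M M0 MP] := bd _ hzI.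
have S0 : 0 <= \sum_(i < n) Mi i by apply: sumr_ge0 => i _; exact: (MiP i).1.
exists (Num.max (\sum_(i < n) Mi i) (`|z0| + M)); first by rewrite le_max S0.
move=> t /[dup] t0T /andP[t0 tT]; rewrite pair_normE ge_max !le_max; apply/andP; split.
  apply/orP; left; apply: rV_norm_le => // i.
  apply: (le_trans ((MiP i).2 t t0T)); rewrite (bigD1 i)//= lerDl.
  by apply: sumr_ge0 => j _; exact: (MiP j).1.
apply/orP; right => /=.
have [_ [_ ->]] := sol.2 t t0 (lte_trans_fin tT TTm).
by apply: (le_trans (ler_normD _ _)); rewrite lerD2l MP.
Qed.

(** Once the state is known to be bounded, essential boundedness of the inputs bounds the right-hand
    side almost everywhere. *)
Lemma sol_lipschitz T : 0 <= T -> (T%:E < Tm)%E ->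
  exists2 M, 0 <= M & forall s t, 0 <= s -> s <= t -> t <= T ->
    `|x t - x s| <= M * (t - s).
Proof.
move=> T0 TTm; have [K K0 KP] := sol_bounded T0 TTm.
pose K' := Num.max K (Num.max (linf_norm d) (linf_norm theta)).
have KK' : K <= K' by rewrite /K' le_max lexx.
have adm : {ae mu, forall s, 0 <= s -> admissible K' (theta s, d s)}.
  by apply: ae_admissible; rewrite /K' !le_max lexx !orbT.
have [M M0 MP] := vfield_bounded K'.
exists M => // s t s0 st tT.
have tTm : (t%:E < Tm)%E by apply: le_lt_trans TTm; rewrite lee_fin.
have Mts : 0 <= M * (t - s) by rewrite mulr_ge0// subr_ge0.
have vb : {ae mu, forall r, s <= r <= t -> `|vfield (x r) (theta r) (d r)| <= M}.
  apply: ae_sub adm => r hr /andP[sr rt]; have r0 := le_trans s0 sr.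
  apply: (MP (theta r, d r) (x r) (hr r0)).
  by apply: le_trans KK'; apply: KP; rewrite r0 (le_trans rt tT).
rewrite pair_normE ge_max /=; apply/andP; split.
  apply: rV_norm_le => // i; rewrite !mxE.
  have [Ii ->] := sol_xi_increment i s0 st tTm.
  apply: Rintegral_norm_le_ae => //; apply: ae_sub vb => r hr /hr.
  rewrite pair_normE ge_max /= => /andP[+ _]; apply: le_trans.
  exact: rV_norm_ge_entry.
have [Iz ->] := sol_z_increment s0 st tTm.
apply: Rintegral_norm_le_ae => //; apply: ae_sub vb => r hr /hr.
by rewrite pair_normE ge_max /= => /andP[_].
Qed.

Lemma sol_V_lipschitz T : 0 <= T -> (T%:E < Tm)%E ->
  exists2 M, 0 <= M & forall s t, 0 <= s -> s <= t -> t <= T ->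
    `|V (x t) - V (x s)| <= M * (t - s).
Proof.
move=> T0 TTm; have [K K0 KP] := sol_bounded T0 TTm.
have [M M0 MP] := sol_lipschitz T0 TTm.
have [C C0 CP] := C1_lipschitz_on_ball K hVc hVd.
exists (C * M); first exact: mulr_ge0.
move=> s t s0 st tT.
have bt : `|x t| <= K by apply: KP; rewrite tT (le_trans s0 st).
have bs : `|x s| <= K by apply: KP; rewrite s0 (le_trans st tT).
by apply: (le_trans (CP _ _ bs bt)); rewrite -mulrA ler_wpM2l// MP.
Qed.

Lemma sol_V_left_lsc T : 0 <= T -> (T%:E < Tm)%E -> left_lsc (fun t => V (x t)) 0 T.
Proof.
move=> T0 TTm; have [M M0 MP] := sol_V_lipschitz T0 TTm.
move=> t /andP[t0 tT] e e0.
have M1 : 0 < M + 1 by rewrite ltr_wpDl.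
exists (e / (M + 1)); first by rewrite divr_gt0.
move=> s s0 /andP[hs st].
have := MP s t s0 (ltW st) tT; rewrite ler_norml => /andP[_ h].
have : (M + 1) * (t - s) <= e by rewrite mulrC -ler_pdivlMr//; lra.
have : 0 <= t - s by lra.
nra.
Qed.

(** Meant for [ell = 'd V (x s)]: frozen at the left end of the interval, the differential is a
    fixed functional and commutes with the integral coordinate by coordinate. *)
Lemma sol_linear_le (ell : {linear ('rV[R]_n * R)%type -> R}) (A s t : R) :
  0 <= s -> s <= t -> (t%:E < Tm)%E ->
  {ae mu, forall r, s <= r <= t -> ell (vfield (x r) (theta r) (d r)) <= A} ->
  ell (x t - x s) <= A * (t - s).
Proof.
move=> s0 st tTm hA.
have ellE (h : 'rV[R]_n * R) :
    ell h = \sum_(i < n) ell ('e_i, 0) * h.1 ord0 i + ell (0, 1) * h.2.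
  rewrite {1}(pair_sum_delta h) linearD linear_sum /= linearZ /= /GRing.scale /= mulrC.
  congr (_ + _).
  by apply: eq_bigr => i _; rewrite linearZ /= /GRing.scale /= mulrC.
pose g (i : 'I_n) r := f (xi r) (z r) (theta r) (d r) ord0 i.
have Ig i : mu.-integrable `[s, t] (EFin \o g i) by case: (sol_xi_increment i s0 st tTm).
have [Iz zE] := sol_z_increment s0 st tTm.
have [I1 E1] := @Rintegral_lin_comb R _ (index_enum 'I_n) (fun i => ell ('e_i, 0)) g s t Ig.
have I2 : mu.-integrable `[s, t] (EFin \o (fun r => ell (0, 1) * zdot V Gam eps (xi r) (z r))).
  exact: (integrableZl _ (ell (0, 1)) Iz).
have -> : ell (x t - x s) =
    Rintegral mu `[s, t] (fun r => ell (vfield (x r) (theta r) (d r))).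
  transitivity (Rintegral mu `[s, t] (fun r => (\sum_(i < n) ell ('e_i, 0) * g i r) +
      ell (0, 1) * zdot V Gam eps (xi r) (z r))); last first.
    by apply: eq_Rintegral => r _; rewrite [in RHS]ellE.
  rewrite RintegralD// E1 RintegralZl// -zE ellE /=; congr (_ + _).
  apply: eq_bigr => i _; congr (_ * _); rewrite !mxE.
  by have [_ <-] := sol_xi_increment i s0 st tTm.
apply: Rintegral_le_ae => //.
have -> : (fun r => ell (vfield (x r) (theta r) (d r))) =
  (fun r => (\sum_(i < n) ell ('e_i, 0) * g i r) + ell (0, 1) * zdot V Gam eps (xi r) (z r)).
  by apply/funext => r; rewrite ellE.
exact: (integrableD _ I1 I2).
Qed.

Lemma zdot_ge0 u w : 0 <= zdot V Gam eps u w.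
Proof. by rewrite /zdot !mulr_ge0 ?expR_ge0 ?pos_ge0// ltW. Qed.

Lemma sol_z_le (A s t : R) : 0 <= s -> s <= t -> (t%:E < Tm)%E ->
  (forall r, s <= r <= t -> zdot V Gam eps (xi r) (z r) <= A) -> z t - z s <= A * (t - s).
Proof.
move=> s0 st tTm hA; have [Iz ->] := sol_z_increment s0 st tTm.
by apply: Rintegral_le_ae => //; exact: aeW.
Qed.

Lemma sol_z_ge (A s t : R) : 0 <= s -> s <= t -> (t%:E < Tm)%E ->
  (forall r, s <= r <= t -> A <= zdot V Gam eps (xi r) (z r)) -> A * (t - s) <= z t - z s.
Proof.
move=> s0 st tTm hA; have [Iz ->] := sol_z_increment s0 st tTm.
rewrite -Rintegral_cst_itv//; apply: ae_le_Rintegral => //.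
  exact: integrable_cst_itv.
by apply: aeW => r /=; rewrite in_itv; exact: hA.
Qed.

Lemma sol_z_mono s t : 0 <= s -> s <= t -> (t%:E < Tm)%E -> z s <= z t.
Proof.
move=> s0 st tTm; rewrite -subr_ge0 -[0](mul0r (t - s)).
by apply: sol_z_ge => // r _; exact: zdot_ge0.
Qed.

End OneSolution.
End Solutions.

Variables (kap lam rho : R -> R) (a b : R).
Hypotheses
  (hV0 : forall z : R, V (0, z) = 0)
  (hVpos : forall (xi : 'rV[R]_n) (z : R), xi != 0 -> 0 < V (xi, z))
  (hi : forall M : R, 0 < M -> exists K : R, forall (xi : 'rV[R]_n) (z : R),
          - M <= z <= M -> V (xi, z) <= M -> enorm xi <= K)
  (heps : 0 < eps)
  (hkap : classKinf kap) (hlam : classKinf lam) (ha : 0 < a)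
  (hdiss : forall (xi : 'rV[R]_n) (z : R) (th : 'rV[R]_p) (dd : 'rV[R]_l),
     Th th -> D dd ->
     'd V (xi, z) (f xi z th dd, 0) + Gam * expR (- z) * 'd V (xi, z) (0, 1)
         * pos (V (xi, z) - eps)
     <= - rho (V (xi, z)) + chi a b lam kap (enorm dd) (enorm th) (expR z)).

Let ch := chi a b lam kap.

Lemma V_ge0 x : 0 <= V x.
Proof.
by case: x => u w; have [->|/hVpos/ltW ->//] := eqVneq u 0; rewrite hV0.
Qed.

Lemma dini_leW (v : R -> R) (s q q' : R) : q <= q' -> dini_le v s q -> dini_le v s q'.
Proof.
move=> qq h e e0; have [r r0 hr] := h e e0; exists r => // t /[dup] st /andP[st1 _].
by apply: (le_trans (hr t st)); rewrite ler_wpM2r ?lerD2r// subr_ge0 ltW.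
Qed.

Lemma lte_fin_between (s : R) (T : \bar R) : (s%:E < T)%E ->
  exists2 t, s < t & (t%:E < T)%E.
Proof.
case: T => [r|_|//]; last by exists (s + 1); rewrite ?ltrDl ?ltry.
by rewrite lte_fin => sr; exists ((s + r) / 2); rewrite ?lte_fin; lra.
Qed.

Lemma diff_vfield_le (u : 'rV[R]_n * R) th dd : Th th -> D dd ->
  'd V u (vfield u th dd) <= - rho (V u) + ch (enorm dd) (enorm th) (expR u.2).
Proof.
move: u => [xi z] hth hdd; apply: le_trans (hdiss xi z hth hdd).
have -> : vfield (xi, z) th dd = (f xi z th dd, 0) + zdot V Gam eps xi z *: (0, 1 : R).
  by congr pair; rewrite /= ?scaler0 ?addr0 ?add0r// /GRing.scale /= mulr1.
rewrite linearD linearZ /= lerD2l /GRing.scale /= /zdot.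
by rewrite -!mulrA [pos _ * _]mulrC.
Qed.

(** * The Dini inequality and the decay of [V] along a solution *)

Section Estimates.
Variables (theta : R -> 'rV[R]_p) (d : R -> 'rV[R]_l).
Hypotheses (hd : Linf D d) (hth : Linf Th theta).
Variables (xi0 : 'rV[R]_n) (z0 : R) (Tm : \bar R) (xi : R -> 'rV[R]_n) (z : R -> R).
Hypothesis sol : is_solution f V Gam eps theta d xi0 z0 Tm xi z.

Let x t := (xi t, z t).
Let v t := V (x t).
Let supply T := ch (ess_sup_from T (fun t => enorm (d t)))
                   (ess_sup_from T (fun t => enorm (theta t))) (expR (z T)).

Lemma supply_ge0 T : 0 <= supply T.
Proof. by apply: chi_ge0; [exact: ha|exact: hkap.1|exact: expR_ge0]. Qed.

(* The derivative inequality is used only at the frozen state [x s], so that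
   no measurability or continuity of its right-hand side is needed: the
   variation of the state on [s, t] costs O(t - s) by Lipschitz continuity. *)
Lemma sol_dini s : 0 <= s -> (s%:E < Tm)%E -> dini_le v s (supply s - rho (v s)).
Proof.
move=> s0 sTm e e0.
have [T sT TTm] := lte_fin_between sTm.
have T0 : 0 <= T by rewrite (le_trans s0)// ltW.
have [K K0 KP] := sol_bounded sol T0 TTm.
have [M M0 MP] := sol_lipschitz hd hth sol T0 TTm.
pose K' := Num.max K (Num.max (linf_norm d) (linf_norm theta)).
have KK' : K <= K' by rewrite /K' le_max lexx.
have adm : {ae mu, forall s, 0 <= s -> admissible K' (theta s, d s)}.
  by apply: ae_admissible => //; rewrite /K' !le_max lexx !orbT.
have [L L0 LP] := vfield_lipschitz K'.
have [C C0 CP] := diff_pair_bound K' hVc hVd.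
have M1 : 0 < M + 1 by rewrite ltr_wpDl.
(* Half of [e] pays for the first-order remainder of [V] over an increment of size [M * (t - s)];
   the other half pays for replacing the moving state by [x s], at a cost [C * L * M * (t - s)]. *)
pose e1 := e / 2 / (M + 1).
have e10 : 0 < e1 by rewrite !divr_gt0.
have [r r0 rP] := diff_approx (x s) e10.
pose W := C * (L * M) + 1.
have CLM : 0 <= C * (L * M) by rewrite !mulr_ge0// ltW.
have W0 : 0 < W by rewrite ltr_wpDl.
pose h := Num.min (T - s) (Num.min (r / (M + 1)) (e / 2 / W)).
have h0 : 0 < h by rewrite !lt_min subr_gt0 sT !divr_gt0.
exists h => // t /andP[st tsh].
have tT : t <= T.
  have : h <= T - s by rewrite ge_min lexx.
  lra.
have hr : (M + 1) * (t - s) < r.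
  have : h <= r / (M + 1) by rewrite !ge_min lexx orbT.
  by move=> hh; rewrite mulrC -ltr_pdivlMr//; lra.
have hW : W * (t - s) <= e / 2.
  have : h <= e / 2 / W by rewrite !ge_min lexx !orbT.
  by move=> hh; rewrite mulrC -ler_pdivlMr//; lra.
have tTm := lte_trans_fin tT TTm.
have ts0 : 0 <= t - s by rewrite subr_ge0 ltW.
have xts := MP s t s0 (ltW st) tT.
have xr : `|x t - x s| < r by apply: le_lt_trans hr; nra.
have := rP _ xr; rewrite -/(v t) -/(v s) ler_norml => /andP[_ hv].
have xsK : `|x s| <= K' by apply: le_trans KK'; apply: KP; rewrite s0 ltW.
have key : 'd V (x s) (x t - x s) <= (supply s - rho (v s) + e / 2) * (t - s).
  apply: (sol_linear_le sol s0 (ltW st) tTm).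
  apply: ae_sub (ae_and adm (ae_and (Linf_ae hd s0) (Linf_ae hth s0))) => q [h1 [h2 h3]].
  move=> /andP[sq qt]; have q0 := le_trans s0 sq.
  have [Tq Dq _ _] := h1 q0; have xqK : `|x q| <= K'.
    by apply: le_trans KK'; apply: KP; rewrite q0 (le_trans qt).
  rewrite -[vfield (x q) _ _](subrK (vfield (x s) (theta q) (d q))) linearD /=.
  have b1 : 'd V (x s) (vfield (x s) (theta q) (d q)) <= - rho (v s) + supply s.
    apply: (le_trans (diff_vfield_le _ Tq Dq)); rewrite lerD2l.
    apply: (chi_mono _ ha hlam.1 hkap.1); [exact: enorm_ge0|exact: h2|exact: h3| |exact: lexx].
    exact: expR_ge0.
  have b2 : 'd V (x s) (vfield (x q) (theta q) (d q) - vfield (x s) (theta q) (d q)) <= e / 2.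
    apply: (le_trans (ler_norm _)); apply: (le_trans (CP _ _ xsK)).
    apply: le_trans hW.
    apply: (@le_trans _ _ (C * (L * (M * (t - s))))).
      rewrite ler_wpM2l//; apply: (le_trans (LP (theta q, d q) _ _ (h1 q0) xqK xsK)).
      rewrite ler_pM2l//; apply: (le_trans (MP s q s0 sq (le_trans qt tT))).
      by rewrite ler_wpM2l// lerD2r.
    by rewrite /W; nra.
  lra.
have eM : e1 * `|x t - x s| <= e / 2 * (t - s).
  apply: (@le_trans _ _ (e1 * ((M + 1) * (t - s)))).
    by rewrite ler_pM2l//; nra.
  by rewrite mulrA /e1 divfK// gt_eqF.
move: hv key eM; lra.
Qed.

Lemma supply_mono s t : 0 <= s -> s <= t -> (t%:E < Tm)%E -> supply t <= supply s.
Proof.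
move=> s0 st tTm; have t0 := le_trans s0 st.
have es k (A : set 'rV[R]_k) (u : R -> 'rV[R]_k) : Linf A u ->
    ess_sup_from t (fun t => enorm (u t)) <= ess_sup_from s (fun t => enorm (u t)).
  move=> uA; apply: (ess_sup_from_mono st (fun t => enorm_ge0 (u t))).
  exact: Linf_ae uA s0.
apply: (chi_mono _ ha hlam.1 hkap.1); [|exact: es hd|exact: es hth| |].
- apply: (ae_ubound_ge0 (fun t => enorm_ge0 (d t))); exact: Linf_ae hd t0.
- exact: expR_ge0.
- by rewrite ler_expR; exact: (sol_z_mono sol).
Qed.

(** Valid from any restart time [s], because the supply frozen at [s] dominates all later ones. *)
Lemma sol_decay gam sg s t : decay_estimate rho gam sg ->
  0 <= s -> s <= t -> (t%:E < Tm)%E ->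
  v t <= sg (v s) (t - s) + gam (supply s).
Proof.
move=> dec s0 st tTm; have t0 := le_trans s0 st.
apply: (dec v s t) => //; first exact: supply_ge0.
- by move=> r _; exact: V_ge0.
- exact: (left_lscW s0 (lexx t) (sol_V_left_lsc hd hth sol t0 tTm)).
- move=> r /andP[sr rt]; have rTm := lte_trans_fin (ltW rt) tTm.
  apply: dini_leW (sol_dini (le_trans s0 sr) rTm).
  by rewrite lerD2r; exact: supply_mono.
- by rewrite st lexx.
Qed.

Lemma sol_z_continuous T : 0 <= T -> (T%:E < Tm)%E -> {within `[0, T], continuous z}.
Proof.
move=> T0 TTm; have [_ [hzI _]] := sol.2 T T0 TTm.
have gc := parameterized_integral_continuous T0 hzI.
apply: (@subspace_eq_continuous _ _ _ (fun t => z0 +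
  parameterized_integral mu 0 t (fun s => zdot V Gam eps (xi s) (z s)))).
  move=> t; rewrite inE /= in_itv /= => /andP[t0 tT].
  have [_ [_ e]] := sol.2 t t0 (lte_trans_fin tT TTm); exact: esym e.
move=> t; apply: cvgD; first exact: cvg_cst.
exact: gc.
Qed.

End Estimates.

(** * A priori bounds uniform over bounded data *)

Section Gains.
Variables (gam : R -> R) (sg : R -> R -> R).
Hypotheses (hgam : classKinf gam) (hsg : classKL sg) (hdec : decay_estimate rho gam sg).

(** For large [z] the threshold [lam (expR z)] exceeds [k - b] and removes the second term, and
    [1 + kap (expR z)] divides what remains, [a * k ^+ 2]. Unboundedness of [lam] and [kap] is used
    here. *)
Lemma chi_small (k q : R) : 0 < q -> exists Z, ch k k (expR Z) <= q.
Proof.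
move=> q0.
have [r1 [r10 hr1]] := classKinf_unbounded hlam (k - b).
have [r2 [r20 hr2]] := classKinf_unbounded hkap (a * k ^+ 2 / q).
pose r := Num.max 1 (Num.max r1 r2).
have rr1 : r1 <= r by rewrite !le_max lexx !orbT.
have rr2 : r2 <= r by rewrite !le_max lexx !orbT.
have r0 : 0 < r by rewrite !lt_max ltr01.
exists (ln r); rewrite lnK ?posrE// /ch /chi.
have lr : k - b <= lam r by apply: (le_trans hr1); exact: (classK_mono hlam.1).
have kr : a * k ^+ 2 / q <= kap r by apply: (le_trans hr2); exact: (classK_mono hkap.1).
have -> : pos (k - b - lam r) = 0 by rewrite /pos max_r// subr_le0.
have k0 : 0 <= kap r by apply: (classK_ge0 hkap.1); exact: ltW.
rewrite expr0n addr0 ler_pdivrMr; last by lra.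
by rewrite ler_pdivrMr// in kr; nra.
Qed.

Lemma classK_small (al : R -> R) (e : R) : classK al -> 0 < e ->
  exists2 q, 0 < q & al q <= e.
Proof.
move=> [alc [al0 _]] e0.
have : al (harmonic k) @[k --> \oo] --> al 0.
  apply: (@within_continuous_cvg nat R R \oo _ [set s | 0 <= s]) => //=.
  exact: cvg_harmonic.
rewrite al0 => /cvgrPdist_le /(_ e e0) [N _ hN].
exists (harmonic N); first exact: harmonic_gt0.
apply: (le_trans (ler_norm _)).
by have := hN N (leqnn N); rewrite sub0r normrN.
Qed.

Lemma sg_mono s s' t : 0 <= t -> 0 <= s -> s <= s' -> sg s t <= sg s' t.
Proof. by move=> t0; case: hsg => _ [/(_ t t0) h _]; exact: (classK_mono h). Qed.

Lemma sg_ge0 s t : 0 <= t -> 0 <= s -> 0 <= sg s t.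
Proof. by move=> t0; case: hsg => _ [/(_ t t0) h _]; exact: (classK_ge0 h). Qed.

Lemma sg_le s t1 t2 : 0 <= s -> 0 <= t1 -> t1 <= t2 -> sg s t2 <= sg s t1.
Proof. by move=> s0; case: hsg => _ [_ /(_ s s0)[h _]]; exact: h. Qed.

Lemma sg_small s e : 0 <= s -> 0 < e -> exists2 t, 0 <= t & sg s t <= e.
Proof.
move=> s0 e0; case: hsg => _ [_ /(_ s s0)[_ /cvgrPdist_le /(_ e e0) [N [_ hN]]]].
pose t := Num.max 0 (N + 1); exists t; first by rewrite le_max lexx.
have := hN t; rewrite sub0r normrN /t lt_max ltrDl ltr01 orbT => /(_ isT).
exact: le_trans (ler_norm _).
Qed.

(* Once [z] exceeds the threshold [Zm], the supply rate is so small that [V]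
   falls below [eps] within time [Te], after which [z] is frozen. *)
Lemma apriori_bound (k : nat) : exists2 B : R, k%:R <= B &
  forall theta d xi0 z0 Tm xi z, Linf D d -> Linf Th theta ->
    is_solution f V Gam eps theta d xi0 z0 Tm xi z ->
    `|xi0| <= k%:R -> `|z0| <= k%:R -> linf_norm d <= k%:R -> linf_norm theta <= k%:R ->
    forall t, 0 <= t -> (t%:E < Tm)%E -> enorm (xi t) <= B /\ z t <= B.
Proof.
have gK := hgam.1.
have k0 : 0 <= k%:R :> R by [].
have [Vk Vk0 VkP] := V_bounded k%:R.
pose X := ch k%:R k%:R (expR (- k%:R)).
have X0 : 0 <= X by apply: chi_ge0; [exact: ha|exact: hkap.1|exact: expR_ge0].
pose Vm := sg Vk 0 + gam X.
have Vm0 : 0 <= Vm by rewrite addr_ge0 ?sg_ge0// (classK_ge0 gK).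
have e2 : 0 < eps / 2 by rewrite divr_gt0.
(* [eps] is split in half: [gam q] absorbs the supply above the threshold, [sg] the transient after
   time [Te]. *)
have [q q0 gq] := classK_small gK e2.
have [Z hZ] := chi_small k%:R q0.
have [Te Te0 hTe] := sg_small Vm0 e2.
(* Including [k] puts the initial [z] below the threshold, so that a crossing time exists whenever
   [z] exceeds it. *)
pose Zm := Num.max k%:R Z.
(* A bound on the speed of [z], since [z >= - k] and [V <= Vm]; hence [z] gains at most [Q * Te]
   during the time [Te] after the crossing. *)
pose Q := Gam * expR k%:R * Vm.
have Q0 : 0 <= Q by rewrite !mulr_ge0 ?expR_ge0// ltW.
pose M1 := Zm + Q * Te.
(* One constant for (i), dominating [- z], [z] and [V] at once; the added 1 makes it positive. *)
pose M := Num.max (Num.max M1 Vm) k%:R + 1.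
have MM1 : M1 <= M by rewrite /M ler_wpDr// !le_max lexx.
have MVm : Vm <= M by rewrite /M ler_wpDr// !le_max lexx orbT.
have Mk : k%:R <= M by rewrite /M ler_wpDr// !le_max lexx orbT.
have M0 : 0 < M by rewrite /M ltr_wpDl// !le_max k0 !orbT.
have [K KP] := hi M0.
exists (Num.max (Num.max K M1) k%:R); first by rewrite le_max lexx orbT.
move=> theta d xi0 z0 Tm xi z hd hth sol xi0k z0k dk tk.
have [xi00 z00] := sol_initial sol.
have zlo t : 0 <= t -> (t%:E < Tm)%E -> - k%:R <= z t.
  move=> t0 tTm; apply: le_trans (sol_z_mono sol (lexx 0) t0 tTm).
  by rewrite z00; move: z0k; rewrite ler_norml => /andP[].
have d0 := linf_norm_ge0 hd.
have vVm t : 0 <= t -> (t%:E < Tm)%E -> V (xi t, z t) <= Vm.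
  move=> t0 tTm.
  apply: (le_trans (sol_decay hd hth sol hdec (lexx 0) t0 tTm)); apply: lerD.
    rewrite subr0; apply: (@le_trans _ _ (sg Vk t)); last exact: sg_le.
    apply: sg_mono => //; first exact: V_ge0.
    apply: (le_trans (ler_norm _)); apply: VkP.
    by rewrite xi00 z00 pair_normE /= ge_max xi0k.
  apply: (classK_mono gK); first exact: supply_ge0.
  apply: (chi_mono _ ha hlam.1 hkap.1); [exact: d0|exact: dk|exact: tk|exact: expR_ge0|].
  by rewrite ler_expR z00; move: z0k; rewrite ler_norml => /andP[].
have zdQ t : 0 <= t -> (t%:E < Tm)%E -> zdot V Gam eps (xi t) (z t) <= Q.
  move=> t0 tTm; rewrite /zdot /Q; apply: ler_pM; rewrite ?pos_ge0//.
  - by rewrite mulr_ge0 ?expR_ge0// ltW.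
  - by rewrite ler_pM2l// ler_expR; have := zlo t t0 tTm; lra.
  - by rewrite /pos ge_max Vm0 andbT; have := vVm t t0 tTm; move: heps; lra.
have zM1 t : 0 <= t -> (t%:E < Tm)%E -> z t <= M1.
  move=> t0 tTm; have QT : 0 <= Q * Te by exact: mulr_ge0.
  have [zZ|Zz] := leP (z t) Zm; first by rewrite /M1; lra.
  have zZm : z 0 <= Zm.
    rewrite z00 /Zm le_max; apply/orP; left.
    exact: le_trans (ler_norm _) z0k.
  have [t1] : exists2 t1, t1 \in `[0, t] & z t1 = Zm.
    apply: IVT => //; first exact: (sol_z_continuous sol).
    by apply/andP; split; [rewrite ge_min zZm | rewrite le_max (ltW Zz) orbT].
  rewrite in_itv /= => /andP[t10 t1t] zt1.
  have [tT|Tt] := leP t (t1 + Te).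
    have zQ r : t1 <= r <= t -> zdot V Gam eps (xi r) (z r) <= Q.
      move=> /andP[r1 r2]; apply: zdQ; first exact: le_trans r1.
      exact: lte_trans_fin tTm.
    have := sol_z_le sol t10 t1t tTm zQ; rewrite zt1 /M1.
    have : Q * (t - t1) <= Q * Te by rewrite ler_wpM2l//; lra.
    lra.
  have t2 : t1 <= t1 + Te by rewrite lerDl.
  have t2Tm := lte_trans_fin (ltW Tt) tTm.
  have zQ r : t1 <= r <= t1 + Te -> zdot V Gam eps (xi r) (z r) <= Q.
    move=> /andP[r1 r2]; apply: zdQ; first exact: le_trans r1.
    exact: lte_trans_fin t2Tm.
  have h1 := sol_z_le sol t10 t2 t2Tm zQ.
  (* The decay estimate is restarted at the crossing time [t1], where [z = Zm] makes the supply at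
     most [q] and [V] is at most [Vm]. *)
  have zz r : t1 + Te <= r <= t -> zdot V Gam eps (xi r) (z r) <= 0.
    move=> /andP[r1 r2]; rewrite /zdot.
    have rTm := lte_trans_fin r2 tTm.
    have t1r := le_trans t2 r1.
    rewrite (_ : pos _ = 0) ?mulr0//; rewrite /pos max_r// subr_le0.
    apply: (le_trans (sol_decay hd hth sol hdec t10 t1r rTm)).
    have -> : eps = eps / 2 + eps / 2 by lra.
    apply: lerD.
      apply: le_trans hTe; apply: (@le_trans _ _ (sg Vm (r - t1))).
        apply: sg_mono; [lra|exact: V_ge0|].
        exact: vVm (lte_trans_fin t1r rTm).
      by apply: sg_le => //; lra.
    apply: le_trans gq; apply: (classK_mono gK); first exact: supply_ge0.
    apply: le_trans hZ; have es j (A : set 'rV[R]_j) (u : R -> 'rV[R]_j) : Linf A u ->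
        linf_norm u <= k%:R -> 0 <= ess_sup_from t1 (fun t => enorm (u t)) <= k%:R.
      move=> uA uk; have ut := Linf_ae uA t10.
      rewrite (ae_ubound_ge0 (fun t => enorm_ge0 (u t)) ut) /=; apply: le_trans uk.
      apply: (ess_sup_from_mono t10 (fun t => enorm_ge0 (u t))).
      exact: (Linf_ae uA (lexx 0)).
    have /andP[e1 e3] := es _ _ _ hd dk; have /andP[_ e4] := es _ _ _ hth tk.
    apply: (chi_mono _ ha hlam.1 hkap.1); [exact: e1|exact: e3|exact: e4|exact: expR_ge0|].
    by rewrite ler_expR zt1 /Zm le_max lexx orbT.
  have t20 : 0 <= t1 + Te by rewrite addr_ge0.
  have h2 := sol_z_le sol t20 (ltW Tt) tTm zz.
  move: h1 h2; rewrite zt1 /M1 mul0r; have -> : t1 + Te - t1 = Te by ring.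
  lra.
move=> t t0 tTm; split; last first.
  by apply: (le_trans (zM1 t t0 tTm)); rewrite !le_max lexx orbT.
apply: (@le_trans _ _ K); last by rewrite !le_max lexx.
apply: (KP _ (z t)); last exact: le_trans (vVm t t0 tTm) MVm.
rewrite (le_trans (zM1 t t0 tTm) MM1) andbT.
by apply: le_trans (zlo t t0 tTm); rewrite lerN2.
Qed.

(** * Existence and uniqueness of solutions *)

Section Wellposed.
Variables (theta : R -> 'rV[R]_p) (d : R -> 'rV[R]_l).
Hypotheses (hd : Linf D d) (hth : Linf Th theta).

Lemma sol_curve xi0 z0 Tm xi z T :
  is_solution f V Gam eps theta d xi0 z0 Tm xi z -> (T%:E < Tm)%E ->
  integral_curve T (row_join (xi0, z0))
    (fun s => row_join (vfield (xi s, z s) (theta s) (d s))) (fun s => row_join (xi s, z s)).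
Proof.
move=> sol TTm t /andP[t0 tT] i.
have [h [hz hzE]] := sol.2 t t0 (lte_trans_fin tT TTm).
case: (split_ordP i) => j ->.
  have E : (fun s => row_join (vfield (xi s, z s) (theta s) (d s)) ord0 (lshift 1 j)) =
           (fun s => f (xi s) (z s) (theta s) (d s) ord0 j).
    by apply/funext => s; rewrite row_joinEl.
  by rewrite E !row_joinEl; exact: h.
have E : (fun s => row_join (vfield (xi s, z s) (theta s) (d s)) ord0 (rshift n j)) =
         (fun s => zdot V Gam eps (xi s) (z s)).
  by apply/funext => s; rewrite row_joinEr.
by rewrite E !row_joinEr; split; [exact: hz|exact: hzE].
Qed.

(** On [[0, t]] both solutions lie in one ball, where the vector field has a single Lipschitz
    constant; [2 * K] is the crude bound that starts the contraction. *)
Lemma sol_unique xi0 z0 Tm xi z Tm' xi' z' t :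
  is_solution f V Gam eps theta d xi0 z0 Tm xi z ->
  is_solution f V Gam eps theta d xi0 z0 Tm' xi' z' ->
  0 <= t -> (t%:E < Tm)%E -> (t%:E < Tm')%E -> xi' t = xi t /\ z' t = z t.
Proof.
move=> sol sol' t0 tTm tTm'.
have [K1 K10 K1P] := sol_bounded sol t0 tTm.
have [K2 K20 K2P] := sol_bounded sol' t0 tTm'.
pose K := Num.max (Num.max K1 K2) (Num.max (linf_norm d) (linf_norm theta)).
have K1K : K1 <= K by rewrite !le_max lexx.
have K2K : K2 <= K by rewrite !le_max lexx orbT.
have adm : {ae mu, forall s, 0 <= s -> admissible K (theta s, d s)}.
  by apply: ae_admissible => //; rewrite !le_max lexx !orbT.
have [L L0 LP] := vfield_lipschitz K.
have E : row_join (xi' t, z' t) = row_join (xi t, z t).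
  apply: (@integral_curve_unique R (n + 1) t L (2 * K) _ _ _ _ _ L0
    (sol_curve sol' tTm') (sol_curve sol tTm)); last by rewrite t0 lexx.
  - apply: ae_sub adm => s hs /andP[s0 st].
    rewrite row_joinB; apply: (le_trans (row_join_norm_le _)).
    apply: (le_trans (LP (theta s, d s) _ _ (hs s0) _ _)).
    + by apply: le_trans K2K; apply: K2P; rewrite s0.
    + by apply: le_trans K1K; apply: K1P; rewrite s0.
    rewrite ler_pM2l// row_joinB -[X in `|X| <= _]row_joinK; exact: row_split_norm_le.
  - move=> s s0t; rewrite row_joinB; apply: (le_trans (row_join_norm_le _)).
    apply: (le_trans (ler_normB _ _)).
    by have := K1P s s0t; have := K2P s s0t; lra.
by have := congr1 row_split E; rewrite !row_joinK => -[].
Qed.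

Lemma vfield_measurable (E : set (measurableTypeR R)) (u : R -> 'rV[R]_n * R) i :
  measurable E -> (forall s, E s -> 0 <= s) -> continuous u ->
  measurable_fun E (fun s => row_join (vfield (u s) (theta s) (d s)) ord0 i).
Proof.
move=> mE E0 uc.
have mreal (g : R -> R) : continuous g -> measurable_fun E g.
  by move=> gc; apply: (measurable_funTS (D := E)); exact: continuous_measurable_fun.
have bu1 : ball_measurable E (fun s => (u s).1).
  apply: (ball_measurable_row mE) => j; apply: mreal => s.
  apply: (@continuous_comp _ _ _ (fun s => (u s).1) (fun x : 'rV[R]_n => x ord0 j));
    last exact: entry_continuous.
  by apply: (@continuous_comp _ _ _ u fst); [exact: uc|exact: cvg_fst].
have bu2 : ball_measurable E (fun s => (u s).2).
  apply: (ball_measurable_real mE); apply: mreal => s.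
  by apply: (@continuous_comp _ _ _ u snd); [exact: uc|exact: cvg_snd].
have binp k (A : set 'rV[R]_k) (w : R -> 'rV[R]_k) : Linf A w -> ball_measurable E w.
  move=> [_ [mw _]]; apply: (ball_measurable_row mE) => j.
  have mj := mw j.
  apply: (measurable_funS _ _ mj) => //.
  rewrite (_ : [set t : R | 0 <= t] = `[0, +oo[%classic); first exact: measurable_itv.
  by apply/seteqP; split => t /=; rewrite in_itv /= andbT.
case: (split_ordP i) => j ->.
  rewrite (_ : (fun s => _) = fun s => f (u s).1 (u s).2 (theta s) (d s) ord0 j); last first.
    by apply/funext => s; rewrite row_joinEl.
  apply: (@measurable_within_continuous_comp R E ('rV[R]_n * R * 'rV[R]_p * 'rV[R]_l)%type
    [set x | Th x.1.2 /\ D x.2] (fun x => f x.1.1.1 x.1.1.2 x.1.2 x.2 ord0 j)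
    (fun s => ((u s).1, (u s).2, theta s, d s))).
  - move=> x; apply: (@continuous_comp _ _ _ _ (fun x : 'rV[R]_n => x ord0 j)).
      exact: hfc.
    exact: entry_continuous.
  - apply: ball_measurable_pair => //; last exact: binp hd.
    by apply: ball_measurable_pair => //; [exact: ball_measurable_pair | exact: binp hth].
  - by move=> s /E0 s0 /=; split; [exact: hth.1|exact: hd.1].
rewrite (_ : (fun s => _) = fun s => zdot V Gam eps (u s).1 (u s).2); last first.
  by apply/funext => s; rewrite row_joinEr.
apply: mreal => s.
apply: (@continuous_comp _ _ _ u (fun a : 'rV[R]_n * R => zdot V Gam eps a.1 a.2)).
  exact: uc.
exact: zdot_continuous.
Qed.

(** Inside the box truncation is the identity, so the curve solves the original system for as long
    as it stays there. *)
Lemma curve_sol (K : R) (y : R -> 'rV[R]_(n + 1)) u0 Tm : (0 < Tm)%E ->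
  (forall T, integral_curve T (row_join u0)
     (fun s => row_join (vfield (clamp_pair K (row_split (y s))) (theta s) (d s))) y) ->
  (forall s, 0 <= s -> (s%:E < Tm)%E -> `|row_split (y s)| <= K) ->
  is_solution f V Gam eps theta d u0.1 u0.2 Tm
    (fun t => lsubmx (y t)) (fun t => y t ord0 (rshift n ord0)).
Proof.
move=> Tm0 yc yK; split => // t t0 tTm.
have ytK s : `[0, t]%classic s -> clamp_pair K (row_split (y s)) = row_split (y s).
  rewrite /= in_itv /= => /andP[s0 st]; apply: clamp_pair_id; apply: yK => //.
  exact: lte_trans_fin tTm.
have t0t : 0 <= t <= t by rewrite t0 lexx.
split => [i|].
  have [I1 E1] := yc t t t0t (lshift 1 i).
  have E : {in `[0, t]%classic, (fun s =>
       row_join (vfield (clamp_pair K (row_split (y s))) (theta s) (d s)) ord0 (lshift 1 i))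
     =1 fun s => f (lsubmx (y s)) (y s ord0 (rshift n ord0)) (theta s) (d s) ord0 i}.
    by move=> s; rewrite inE => /ytK e; rewrite row_joinEl e.
  split.
    by apply: eq_integrable I1 => // s /E /= ->.
  by rewrite mxE E1 row_joinEl; congr (_ + _); apply: eq_Rintegral => s /E.
have [I1 E1] := yc t t t0t (rshift n ord0).
have E : {in `[0, t]%classic, (fun s =>
     row_join (vfield (clamp_pair K (row_split (y s))) (theta s) (d s)) ord0 (rshift n ord0))
   =1 fun s => zdot V Gam eps (lsubmx (y s)) (y s ord0 (rshift n ord0))}.
  by move=> s; rewrite inE => /ytK e; rewrite row_joinEr e.
split.
  by apply: eq_integrable I1 => // s /E /= ->.
by rewrite E1 row_joinEr; congr (_ + _); apply: eq_Rintegral => s /E.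
Qed.

(* The equation is solved globally with the state clamped to a box that is
   larger than the a priori bound; the solution then never leaves the box. *)
Lemma sol_exists (k : nat) xi0 z0 : `|xi0| <= k%:R -> `|z0| <= k%:R ->
  linf_norm d <= k%:R -> linf_norm theta <= k%:R ->
  exists xi z, is_solution f V Gam eps theta d xi0 z0 +oo%E xi z.
Proof.
move=> xi0k z0k dk tk; have [B kB BP] := apriori_bound k.
have k0 : 0 <= k%:R :> R by [].
(* The margin 1 is the room in which the curve is still a true solution slightly beyond a time up to
   which it is bounded by [B]; the a priori bound then restores [B]. *)
pose K := B + 1.
have K0 : 0 <= K by rewrite /K; lra.
have BK : B <= K by rewrite /K; lra.
have kK := le_trans kB BK.
have adm : {ae mu, forall s, 0 <= s -> admissible K (theta s, d s)}.
  by apply: ae_admissible => //; exact: le_trans kK.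
have [L L0 LP] := vfield_lipschitz K.
have [M M0 MP] := vfield_bounded K.
pose F s w := row_join (vfield (clamp_pair K (row_split w)) (theta s) (d s)).
have Fm w : continuous w -> forall i t,
    measurable_fun (`[0, t]%classic : set (measurableTypeR R)) (fun s => F s (w s) ord0 i).
  move=> wc i t; apply: vfield_measurable; first exact: measurable_itv.
    by move=> s /=; rewrite in_itv /= => /andP[].
  exact: clamp_split_continuous.
have FL : {ae mu, forall s, 0 <= s -> forall u w, `|F s u - F s w| <= L * `|u - w|}.
  apply: ae_sub adm => s hs s0 u w; rewrite row_joinB.
  apply: (le_trans (row_join_norm_le _)).
  apply: (le_trans (LP (theta s, d s) _ _ (hs s0) (clamp_pair_le _ K0) (clamp_pair_le _ K0))).
  rewrite ler_pM2l//; apply: (le_trans (clamp_pair_lip _ _ _)).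
  by rewrite row_splitB; exact: row_split_norm_le.
have FM : {ae mu, forall s, 0 <= s -> forall u, `|F s u| <= M}.
  apply: ae_sub adm => s hs s0 u; apply: (le_trans (row_join_norm_le _)).
  exact: (MP (theta s, d s) _ (hs s0) (clamp_pair_le _ K0)).
have [y [yc yI]] := integral_curve_exists (row_join (xi0, z0)) L0 M0 Fm FL FM.
have near_y t (e : R) : 0 < e -> exists2 h, 0 < h & forall s, `|t - s| < h ->
    `|row_split (y t) - row_split (y s)| < e.
  move=> e0; have /cvgrPdist_lt /(_ e e0) [h /= h0 hP] := yc t.
  exists h => // s ts; rewrite row_splitB; apply: (le_lt_trans (row_split_norm_le _)).
  exact: hP.
have y0 : row_split (y 0) = (xi0, z0).
  have -> : y 0 = row_join (xi0, z0); last exact: row_joinK.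
  apply/rowP => i; have [_ ->] := yI 0 0 (ltac:(by rewrite lexx)) i.
  by rewrite set_itv1 Rintegral_set1 addr0.
have yB T : forall t, 0 <= t <= T -> `|row_split (y t)| <= B.
  apply: real_induction.
  - by rewrite y0 pair_normE /= ge_max !(le_trans _ kB).
  - move=> t /andP[t0 _] yt.
    have [h h0 hP] := near_y t 1 ltr01.
    exists h => // s /andP[ts sth].
    have sTm : (s%:E < (t + h)%:E)%E by rewrite lte_fin.
    have s0 : 0 <= s by rewrite (le_trans t0)// ltW.
    have sol : is_solution f V Gam eps theta d xi0 z0 (t + h)%:E
        (fun t => lsubmx (y t)) (fun t => y t ord0 (rshift n ord0)).
      apply: (@curve_sol K y (xi0, z0)) => //; first by rewrite lte_fin ltr_wpDl.
      move=> r r0; rewrite lte_fin => rth; have [rt|tr] := leP r t.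
        by apply: le_trans BK; apply: yt; rewrite r0.
      have h1 := hP r (ltac:(rewrite distrC gtr0_norm; lra)).
      have h2 := yt t (ltac:(by rewrite t0 lexx)).
      have := ler_normB (row_split (y t)) (row_split (y t) - row_split (y r)).
      by rewrite opprB addrC subrK /K; lra.
    have [b1 b2] := BP _ _ _ _ _ _ _ hd hth sol xi0k z0k dk tk s s0 sTm.
    rewrite pair_normE ge_max; apply/andP; split.
      exact: le_trans (norm_le_enorm _) b1.
    rewrite ler_norml b2 andbT.
    (* The a priori bound controls [z] only from above; from below, monotonicity gives
       [z >= z0 >= - k >= - B]. *)
    apply: le_trans (sol_z_mono sol (lexx 0) s0 sTm).
    have -> : y 0 ord0 (rshift n ord0) = z0 by have := congr1 snd y0.
    by move: z0k; rewrite ler_norml => /andP[z0k _]; apply: le_trans z0k; rewrite lerN2.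
  - move=> t /andP[t0 _] yt; apply/ler_addgt0Pr => e e0.
    have [h h0 hP] := near_y t e e0.
    pose s := t - Num.min (h / 2) t.
    have m0 : 0 < Num.min (h / 2) t by rewrite lt_min t0 divr_gt0.
    have m1 : Num.min (h / 2) t <= h / 2 by rewrite ge_min lexx.
    have m2 : Num.min (h / 2) t <= t by rewrite ge_min lexx orbT.
    have h1 := hP s (ltac:(rewrite /s gtr0_norm; lra)).
    have h2 := yt s (ltac:(rewrite /s; apply/andP; split; lra)).
    have := ler_normD (row_split (y t) - row_split (y s)) (row_split (y s)); rewrite subrK; lra.
exists (fun t => lsubmx (y t)), (fun t => y t ord0 (rshift n ord0)).
apply: (@curve_sol K y (xi0, z0)) => //.
by move=> s s0 _; apply: le_trans BK; apply: (yB s); rewrite s0 lexx.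
Qed.

End Wellposed.

Hypothesis hrho : classKinf rho.

(** * Asymptotic bounds *)

Section GlobalSolution.
Variables (theta : R -> 'rV[R]_p) (d : R -> 'rV[R]_l).
Hypotheses (hd : Linf D d) (hth : Linf Th theta).
Variables (xi0 : 'rV[R]_n) (z0 : R) (xi : R -> 'rV[R]_n) (z : R -> R) (zinf : R).
Hypotheses (sol : is_solution f V Gam eps theta d xi0 z0 +oo%E xi z)
  (zle : forall t, 0 <= t -> z t <= zinf) (zcvg : z t @[t --> +oo] --> zinf).

Let v t := V (xi t, z t).

(* Barbalat's argument: an excursion of [v] above [eps + e] lasts long enough,
   because [v] grows at bounded rate, to increase [z] by a fixed amount. *)
Lemma limsup_le_eps : (limsupE v <= eps%:E)%E.
Proof.
apply: limsupE_le => e e0.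
pose C := ch (ess_sup_from 0 (fun t => enorm (d t)))
             (ess_sup_from 0 (fun t => enorm (theta t))) (expR (z 0)).
have C0 : 0 <= C by exact: supply_ge0.
pose eta := e / 2; have eta0 : 0 < eta by rewrite divr_gt0.
(* During [dt] the function [v] rises by at most [eta]; so if it exceeds [eps + e] at [t], it was at
   least [eps + eta] on all of [[t - dt, t]]. *)
pose dt := eta / (C + 1).
have C1 : 0 < C + 1 by rewrite ltr_wpDl.
have dt0 : 0 < dt by rewrite divr_gt0.
have Cdt : C * dt <= eta.
  by rewrite /dt mulrCA ler_piMr ?(ltW eta0)// ler_pdivrMr//; lra.
(* A lower bound on the speed of [z] during such an excursion, uniform because [z <= zinf]. An
   increase [A * dt] is impossible once [z] is that close to its limit. *)
pose A := Gam * expR (- zinf) * eta.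
have A0 : 0 < A by rewrite !mulr_gt0// expR_gt0.
have Adt : 0 < A * dt by rewrite mulr_gt0.
have /cvgrPdist_lt /(_ _ Adt) [T1 [_ hT1]] := zcvg.
pose T2 := Num.max 0 (T1 + 1).
have T20 : 0 <= T2 by rewrite le_max lexx.
have T12 : T1 < T2 by rewrite lt_max ltrDl ltr01 orbT.
exists (T2 + dt); first by rewrite addr_ge0// ltW.
move=> t Tt; rewrite leNgt; apply/negP => vt.
pose s := t - dt.
have sT2 : T2 <= s by rewrite /s; lra.
have s0 : 0 <= s by exact: le_trans sT2.
have st : s <= t by rewrite /s; lra.
have t0 : 0 <= t by exact: le_trans st.
have tTm : (t%:E < +oo)%E by exact: ltry.
have vr r : s <= r <= t -> eps + eta <= v r.
  move=> /andP[sr rt]; have r0 := le_trans s0 sr.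
  have Dq q : r <= q < t -> exists2 q', dini_le v q q' & q' <= C.
    move=> /andP[rq _]; have q0 := le_trans r0 rq.
    have qTm : (q%:E < +oo)%E by exact: ltry.
    eexists; first exact: (sol_dini hd hth sol q0 qTm).
    have := supply_mono hd hth sol (lexx 0) q0 qTm; rewrite -/C.
    have : 0 <= rho (v q) by apply: (classK_ge0 hrho.1); exact: V_ge0.
    rewrite /v; lra.
  have := dini_le_linear_bound (left_lscW r0 (lexx t) (sol_V_left_lsc hd hth sol t0 tTm))
    Dq (introT andP (conj rt (lexx t))).
  have : C * (t - r) <= C * dt by rewrite ler_wpM2l//; move: sr; rewrite /s; lra.
  move: vt Cdt; rewrite /eta /v; lra.
have zd r : s <= r <= t -> A <= zdot V Gam eps (xi r) (z r).
  move=> /[dup] /vr hv /andP[sr rt]; rewrite /A /zdot; apply: ler_pM.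
  - by rewrite mulr_ge0 ?expR_ge0// ltW.
  - exact: ltW.
  - by rewrite ler_pM2l// ler_expR lerN2 zle// (le_trans s0).
  - by rewrite /pos le_max; apply/orP; left; move: hv; rewrite /v; lra.
have := sol_z_ge sol s0 st tTm zd.
have -> : t - s = dt by rewrite /s; ring.
have := hT1 s (lt_le_trans T12 sT2); rewrite ltr_norml => /andP[_].
have := zle t0; lra.
Qed.

(** Essential suprema from [T] on decrease to the essential upper limits and [z] converges, so
    continuity of [chi] and [gam] makes the gain at the restart time converge to the asserted
    one. *)
Lemma limsup_le_gain : (limsupE v <= (gam (ch (ess_limsup (fun t => enorm (d t)))
  (ess_limsup (fun t => enorm (theta t))) (expR zinf)))%:E)%E.
Proof.
apply: limsupE_le => e e0; have e2 : 0 < e / 2 by rewrite divr_gt0.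
have cvg_ess k (A : set 'rV[R]_k) (u : R -> 'rV[R]_k) : Linf A u ->
    ess_sup_from T (fun t => enorm (u t)) @[T --> +oo] --> ess_limsup (fun t => enorm (u t)).
  move=> [_ [_ [M uM]]]; apply/cvgrPdist_le => q q0.
  have [T T0 hT] := ess_limsup_approx q0 (fun t => enorm_ge0 (u t)) uM.
  exists T; split; first exact: num_real.
  by move=> T' /ltW /hT /andP[h1 h2]; rewrite distrC ger0_norm ?subr_ge0//; lra.
pose supply T := ch (ess_sup_from T (fun t => enorm (d t)))
  (ess_sup_from T (fun t => enorm (theta t))) (expR (z T)).
pose X := ch (ess_limsup (fun t => enorm (d t)))
  (ess_limsup (fun t => enorm (theta t))) (expR zinf).
have cs : supply T @[T --> +oo] --> X.
  apply: (@chi_cvg _ a b lam kap hlam.1 hkap.1 _ _ _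
    (fun T => ess_sup_from T (fun t => enorm (d t)))
    (fun T => ess_sup_from T (fun t => enorm (theta t))) (fun T => expR (z T))).
  - exact: expR_ge0.
  - by move=> T; exact: expR_ge0.
  - exact: cvg_ess hd.
  - exact: cvg_ess hth.
  - by apply: cvg_comp zcvg _; exact: continuous_expR.
have cg : gam (supply T) @[T --> +oo] --> gam X.
  apply: (within_continuous_cvg hgam.1.1) => //=; last by move=> T; exact: supply_ge0.
  by apply: chi_ge0; [exact: ha|exact: hkap.1|exact: expR_ge0].
have /cvgrPdist_le /(_ _ e2) [T1 [_ hT1]] := cg.
pose T := Num.max 0 (T1 + 1).
have T0 : 0 <= T by rewrite le_max lexx.
have gT : gam (supply T) <= gam X + e / 2.
  have := hT1 T; rewrite lt_max ltrDl ltr01 orbT => /(_ isT).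
  by rewrite ler_norml => /andP[h _]; lra.
have [T2 T20 hT2] := sg_small (V_ge0 (xi T, z T)) e2.
exists (T + T2); first by rewrite addr_ge0.
move=> t Tt; have Tt' : T <= t by lra.
apply: (le_trans (sol_decay hd hth sol hdec T0 Tt' (ltry t))).
have : sg (v T) (t - T) <= e / 2 by apply: le_trans hT2; apply: sg_le; [exact: V_ge0| |]; lra.
move: gT; rewrite /supply /X /v; lra.
Qed.

End GlobalSolution.

Lemma trajectory_estimates : exists B : 'rV[R]_n -> R -> R -> R -> R,
  {within [set x : 'rV[R]_n * R * R * R | 0 <= x.1.2 /\ 0 <= x.2],
     continuous (fun x : 'rV[R]_n * R * R * R => B x.1.1.1 x.1.1.2 x.1.2 x.2)} /\
  thm8_conclusion Th D f V Gam eps ch B gam sg.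
Proof.
have ab (k : nat) : exists B : R, k%:R <= B /\
    forall theta d xi0 z0 Tm xi z, Linf D d -> Linf Th theta ->
    is_solution f V Gam eps theta d xi0 z0 Tm xi z ->
    `|xi0| <= k%:R -> `|z0| <= k%:R -> linf_norm d <= k%:R -> linf_norm theta <= k%:R ->
    forall t, 0 <= t -> (t%:E < Tm)%E -> enorm (xi t) <= B /\ z t <= B.
  by have [B h1 h2] := apriori_bound k; exists B.
have [Bk BkP] := choice ab.
have [H [Hc _ _ HB]] := continuous_majorant Bk.
(* One continuous measure of the size of all data, so that a majorant in one variable gives [B]. *)
pose N (xi0 : 'rV[R]_n) (z0 s1 s2 : R) := `|xi0| + `|z0| + `|s1| + `|s2|.
exists (fun xi0 z0 s1 s2 => H (N xi0 z0 s1 s2)); split.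
  apply: continuous_subspaceT => w.
  apply: (@continuous_comp _ _ _ (fun x : 'rV[R]_n * R * R * R => N x.1.1.1 x.1.1.2 x.1.2 x.2) H);
    last exact: Hc.
  have c1 : {for w, continuous (fun x : 'rV[R]_n * R * R * R => x.1)} by exact: cvg_fst.
  have c2 : {for w, continuous (fun x : 'rV[R]_n * R * R * R => x.2)} by exact: cvg_snd.
  have c11 : {for w, continuous (fun x : 'rV[R]_n * R * R * R => x.1.1)}.
    by apply: (@continuous_comp _ _ _ fst fst); [exact: c1|exact: cvg_fst].
  have c12 : {for w, continuous (fun x : 'rV[R]_n * R * R * R => x.1.2)}.
    by apply: (@continuous_comp _ _ _ fst snd); [exact: c1|exact: cvg_snd].
  have c111 : {for w, continuous (fun x : 'rV[R]_n * R * R * R => x.1.1.1)}.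
    by apply: (@continuous_comp _ _ _ (fun x => x.1.1) fst); [exact: c11|exact: cvg_fst].
  have c112 : {for w, continuous (fun x : 'rV[R]_n * R * R * R => x.1.1.2)}.
    by apply: (@continuous_comp _ _ _ (fun x => x.1.1) snd); [exact: c11|exact: cvg_snd].
  apply: cvgD; last exact: cvg_norm c2.
  apply: cvgD; last exact: cvg_norm c12.
  by apply: cvgD; [exact: cvg_norm c111|exact: cvg_norm c112].
move=> xi0 z0 d theta hd hth.
set NN := N _ _ _ _.
(* The integer with [NN < k <= NN + 1] bounds all data, and its a priori bound [Bk k] lies below
   [H NN]. *)
pose k := (Num.trunc NN).+1.
have d0 := linf_norm_ge0 hd; have t0 := linf_norm_ge0 hth.
have NN0 : 0 <= NN by rewrite /NN /N !addr_ge0.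
have /andP[tr1 tr2] := truncn_itv NN0.
have kNN : k%:R <= NN + 1 by rewrite /k -addn1 natrD lerD2r.
have BH := HB _ _ kNN.
have NNk : NN <= k%:R by exact: ltW.
have a1 : 0 <= `|xi0| by []. have a2 : 0 <= `|z0| by [].
have xi0k : `|xi0| <= k%:R by move: NNk; rewrite /NN /N (ger0_norm d0) (ger0_norm t0); lra.
have z0k : `|z0| <= k%:R by move: NNk; rewrite /NN /N (ger0_norm d0) (ger0_norm t0); lra.
have dk : linf_norm d <= k%:R by move: NNk; rewrite /NN /N (ger0_norm d0) (ger0_norm t0); lra.
have tk : linf_norm theta <= k%:R by move: NNk; rewrite /NN /N (ger0_norm d0) (ger0_norm t0); lra.
have [xi [z sol]] := sol_exists hd hth xi0k z0k dk tk.
have bnd t : 0 <= t -> enorm (xi t) <= Bk k /\ z t <= Bk k.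
  move=> s0; exact: ((BkP k).2 _ _ _ _ _ _ _ hd hth sol xi0k z0k dk tk t s0 (ltry t)).
have [xi00 z00] := sol_initial sol.
exists xi, z; split => //; split.
  move=> Tm xi' z' sol' t s0 tTm; exact: (sol_unique hd hth sol sol' s0 (ltry t) tTm).
(* The limit of the bounded nondecreasing [z] is the supremum of its values. *)
pose S := [set z t | t in [set t : R | 0 <= t]].
have hS : has_sup S.
  split; first by exists (z 0), 0 => //=.
  by exists (Bk k) => _ [t s0 <-]; exact: (bnd t s0).2.
have zle t : 0 <= t -> z t <= sup S.
  by move=> s0; apply: ub_le_sup; [exact: hS.2|exists t].
have zcvg : z t @[t --> +oo] --> sup S.
  apply/cvgrPdist_le => e e0.
  have [_ [s s0 <-] hs] := sup_adherent e0 hS.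
  exists s; split; first exact: num_real.
  move=> t /ltW st; have s0t : 0 <= t by exact: le_trans st.
  rewrite ger0_norm ?subr_ge0 ?zle//.
  by have := sol_z_mono sol s0 st (ltry t); lra.
exists (sup S); split => //; split; first exact: (limsup_le_eps hd hth sol zle zcvg).
split; first exact: (limsup_le_gain hd hth sol zcvg).
split.
  move=> t s0; have := sol_decay hd hth sol hdec (lexx 0) s0 (ltry t).
  by rewrite subr0 xi00 z00.
move=> t s0; split; first exact: le_trans (bnd t s0).1 BH.
split; first by rewrite -z00; exact: (sol_z_mono sol (lexx 0) s0 (ltry t)).
split; first exact: zle.
apply: le_trans BH; apply: ge_sup; first exact: hS.1.
by move=> _ [r r0 <-]; exact: (bnd r r0).2.
Qed.

End Gains.
End System.

(** * The two choices of gain and decay function *)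

Theorem theorem8 (R : realType) (n p l : nat)
  (Th : set 'rV[R]_p) (D : set 'rV[R]_l) (Gam eps : R)
  (f : 'rV[R]_n -> R -> 'rV[R]_p -> 'rV[R]_l -> 'rV[R]_n)
  (V : 'rV[R]_n * R -> R)
  (kap lam rho : R -> R) (a b c delta : R)
  (* standing assumptions *)
  (hTh : closed Th) (hD : closed D) (h0Th : Th 0) (h0D : D 0)
  (hGam : 0 < Gam) (heps : 0 < eps)
  (hfc : {within [set x : 'rV[R]_n * R * 'rV[R]_p * 'rV[R]_l | Th x.1.2 /\ D x.2],
           continuous (fun x : 'rV[R]_n * R * 'rV[R]_p * 'rV[R]_l =>
                         f x.1.1.1 x.1.1.2 x.1.2 x.2)})
  (hfL : forall (xi0 : 'rV[R]_n) (z0 K : R), exists r : R, exists L : R, 0 < r /\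
           forall (xi xi' : 'rV[R]_n) (z z' : R) (th : 'rV[R]_p) (dd : 'rV[R]_l),
             enorm (xi - xi0) < r -> `|z - z0| < r ->
             enorm (xi' - xi0) < r -> `|z' - z0| < r ->
             Th th -> D dd -> enorm th <= K -> enorm dd <= K ->
             enorm (f xi z th dd - f xi' z' th dd) <= L * (enorm (xi - xi') + `|z - z'|))
  (hf0 : forall (z : R) (th : 'rV[R]_p), Th th -> f 0 z th 0 = 0)
  (hVd : forall x : 'rV[R]_n * R, differentiable V x)
  (hVc : forall h : 'rV[R]_n * R, continuous (fun x : 'rV[R]_n * R => 'd V x h))
  (hV0 : forall z : R, V (0, z) = 0)
  (hVpos : forall (xi : 'rV[R]_n) (z : R), xi != 0 -> 0 < V (xi, z))
  (* (i) *)
  (hi : forall M : R, 0 < M -> exists K : R, forall (xi : 'rV[R]_n) (z : R),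
          - M <= z <= M -> V (xi, z) <= M -> enorm xi <= K)
  (* (ii) *)
  (hkap : classKinf kap) (hlam : classKinf lam) (hrho : classKinf rho)
  (ha : 0 < a) (hc : 0 < c) (hdelta : 0 < delta) (hb : 0 <= b)
  (hrhoc : forall s : R, 0 <= s <= delta -> c * s <= rho s)
  (hdiss : forall (xi : 'rV[R]_n) (z : R) (th : 'rV[R]_p) (dd : 'rV[R]_l),
     Th th -> D dd ->
     'd V (xi, z) (f xi z th dd, 0) + Gam * expR (- z) * 'd V (xi, z) (0, 1)
         * pos (V (xi, z) - eps)
     <= - rho (V (xi, z)) + chi a b lam kap (enorm dd) (enorm th) (expR z)) :
  (exists (B : 'rV[R]_n -> R -> R -> R -> R) (gam : R -> R) (sg : R -> R -> R),
     {within [set x : 'rV[R]_n * R * R * R | 0 <= x.1.2 /\ 0 <= x.2],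
        continuous (fun x : 'rV[R]_n * R * R * R => B x.1.1.1 x.1.1.2 x.1.2 x.2)} /\
     classKinf gam /\ classKL sg /\
     thm8_conclusion Th D f V Gam eps (chi a b lam kap) B gam sg) /\
  ((forall s : R, 0 <= s -> c * s <= rho s) ->
   exists B : 'rV[R]_n -> R -> R -> R -> R,
     {within [set x : 'rV[R]_n * R * R * R | 0 <= x.1.2 /\ 0 <= x.2],
        continuous (fun x : 'rV[R]_n * R * R * R => B x.1.1.1 x.1.1.2 x.1.2 x.2)} /\
     thm8_conclusion Th D f V Gam eps (chi a b lam kap) B
       (fun s => s / c) (fun s t => expR (- (c * t)) * s)).
Proof.
have [gam [hgam gamP]] := Kinf_gain_exists hrho hc hdelta hrhoc.
have est gam' sg' : classKinf gam' -> classKL sg' -> decay_estimate rho gam' sg' ->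
    exists B : 'rV[R]_n -> R -> R -> R -> R,
    {within [set x : 'rV[R]_n * R * R * R | 0 <= x.1.2 /\ 0 <= x.2],
        continuous (fun x : 'rV[R]_n * R * R * R => B x.1.1.1 x.1.1.2 x.1.2 x.2)} /\
    thm8_conclusion Th D f V Gam eps (chi a b lam kap) B gam' sg'.
  by move=> h1 h2 h3; exact: (trajectory_estimates hTh hD hGam hfc hfL hVd hVc hV0
    hVpos hi heps hkap hlam ha hdiss h1 h2 h3 hrho).
split.
  (* The rate is that of [Kinf_decay_estimate]: it has the form [k / (A + s)] with
     [k = c * delta / 2] and [A = delta + 1]. *)
  pose sg s t : R := s * expR (- (c * delta / 2 / (delta + 1 + s) * t)).
  have sgKL : classKL sg.
    by apply: classKL_expR_decay; rewrite ?divr_gt0 ?mulr_gt0 ?addr_gt0.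
  have [B [Bc BP]] := est gam sg hgam sgKL
    (Kinf_decay_estimate hrho hc hdelta hrhoc gamP).
  by exists B, gam, sg.
move=> hlin; exact: est (classKinf_linear hc) (classKL_expR_linear hc)
  (linear_decay_estimate hc hlin).
Qed.
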